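(* Let $\zeta$ be an aperiodic primitive substitution of Salem type, such that its substitution matrix has an irreducible characteristic polynomial over $\mathbb{Q}$. Let $\alpha$ be the Perron-Frobenius eigenvalue of the substitution matrix. For every $\omega\in(0,1)\cap\mathbb{Q}(\alpha)$ there exist $C>0$ only depending on the substitution, $r_0=r_0(\omega)>0$ and $\vartheta=\vartheta(\omega)>0$ such that $$\sigma_f(B_r(\omega))\le C\,r^{\vartheta}\quad\text{for all } r<r_0 \text{ and } f\in\mathrm{Cyl}(X_\zeta).$$
   Context: Alphabet and substitution: $\mathcal{A}=\{0,\dots,d-1\}$, $d\ge2$; $\mathcal{A}^+$ is the set of nonempty finite words with letters in $\mathcal{A}$. A substitution is a map $\zeta:\mathcal{A}\to\mathcal{A}^+$, extended to words and sequences by concatenation. The substitution space $X_\zeta$ is the set of bi-infinite sequences $x\in\mathcal{A}^{\mathbb{Z}}$ such that every word in $x$ appears as a subword of $\zeta^n(a)$ for some $a\in\mathcal{A}$, $n\in\mathbb{N}$. $T$ is the left shift on $X_\zeta$. The substitution matrix $S_\zeta$ is the $d\times d$ matrix whose entry $S_\zeta(i,j)$ is the number of symbols $i$ in $\zeta(j)$. $\zeta$ is primitive if some power of $S_\zeta$ has all entries strictly positive; a primitive $\zeta$ is aperiodic (non-periodic) if and only if $X_\zeta$ is infinite. For primitive $\zeta$ the system is uniquely ergodic, and $\mu$ denotes the unique $T$-invariant Borel probability measure. A Salem number is a real algebraic integer greater than $1$ whose conjugates have modulus at most $1$, with at least one having modulus equal to $1$. The substitution $\zeta$ is of Salem type if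 $S_\zeta$ has an irreducible characteristic polynomial and its Perron-Frobenius eigenvalue is a Salem number. $\mathrm{Cyl}(X_\zeta)$ is the space of cylindrical functions of level $0$, that is, functions $f$ on $X_\zeta$ depending only on $x_0$, the $0$-th term of the sequence $x\in X_\zeta$. For $f\in L^2(X_\zeta,\mu)$ the spectral measure $\sigma_f$ is the measure on $\mathbb{R}/\mathbb{Z}\cong[0,1)$ determined by $\int_0^1 e^{2\pi i k\omega}\,d\sigma_f(\omega)=\langle f\circ T^k,f\rangle$, $k\in\mathbb{Z}$, where $\langle\cdot,\cdot\rangle$ is the scalar product in $L^2(X_\zeta,\mu)$. $B_r(\omega)$ is the ball of radius $r$ centered at $\omega$ in $\mathbb{R}/\mathbb{Z}$.
   Formalization: The bound is proved as σ_f(B_r(ω)) ≤ C‖f‖₂² r^ϑ; the factor ‖f‖₂² is added because, with C and r₀ independent of f, the printed inequality fails under scaling f ↦ cf. For ‖f‖₂ ≤ 1 it gives the inequality as printed. *)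

(* Defs.v *)
From HB Require Import structures.
From mathcomp Require Import all_boot all_order all_algebra.
From mathcomp Require Import all_classical all_reals all_analysis.
From mathcomp Require Import complex.
Set Implicit Arguments.
Unset Strict Implicit.
Unset Printing Implicit Defensive.
Import Order.TTheory GRing.Theory Num.Theory.
Import numFieldNormedType.Exports.
Local Open Scope classical_set_scope.
Local Open Scope ring_scope.
Local Open Scope complex_scope.

(* The alphabet is 'I_n.+2: it has d = n + 2 letters, so n ranges over all nat
   exactly when d ranges over the integers >= 2. *)

Record substitution (n : nat) := Substitution {
  subst_fun :> 'I_n.+2 -> seq 'I_n.+2;
  subst_nonempty : forall a, subst_fun a != [::] }.

Definition subst_word n (zeta : substitution n) (w : seq 'I_n.+2) :
    seq 'I_n.+2 :=
  flatten [seq zeta a | a <- w].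

Definition subst_mx n (zeta : substitution n) : 'M[int]_n.+2 :=
  \matrix_(i, j) (count_mem i (zeta j))%:Z.

Definition primitive_subst n (zeta : substitution n) : Prop :=
  exists k : nat, forall i j, 0 < (subst_mx zeta ^+ k) i j.

Definition irreducible_char_poly n (zeta : substitution n) : Prop :=
  irreducible_poly (map_poly (intr : int -> rat) (char_poly (subst_mx zeta))).

(* The library requires measurable types to be pointed. *)
HB.instance Definition _ n := isPointed.Build 'I_n.+1 ord0.

(* Bi-infinite sequences, with the product of the discrete topologies and its
   Borel sigma-algebra. *)
Definition seq_space (n : nat) : topologicalType :=
  prod_topology (fun _ : int => discrete_topology 'I_n.+2).

Notation borel_seq_space n := (g_sigma_algebraType (@open (seq_space n))).

Definition word_at n (x : seq_space n) (i : int) (l : nat) : seq 'I_n.+2 :=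
  [seq (x (i + k%:Z) : 'I_n.+2) | k <- iota 0 l].

Definition subst_space n (zeta : substitution n) : set (seq_space n) :=
  [set x | forall (i : int) (l : nat), exists (a : 'I_n.+2) (m : nat),
     infix (word_at x i l) (iter m (subst_word zeta) [:: a])].

(* The k-th iterate of the left shift. *)
Definition shift_seq n (k : int) (x : seq_space n) : seq_space n :=
  fun i => x (i + k).

Definition aperiodic_subst n (zeta : substitution n) : Prop :=
  infinite_set (subst_space zeta).

(* A shift-invariant Borel probability measure on subst_space zeta, seen as a
   measure on the ambient space of sequences. *)
Definition invariant_probability (R : realType) n (zeta : substitution n)
    (mu : probability (borel_seq_space n) R) : Prop :=
  mu (subst_space zeta) = 1%E /\
  forall A : set (borel_seq_space n), measurable A ->
    mu (shift_seq 1 @^-1` A) = mu A.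

Definition perron_frobenius_eigenvalue (R : realType) n (S : 'M[int]_n.+2)
    (alpha : R) : Prop :=
  eigenvalue (map_mx intr S) alpha /\
  forall z : R[i], eigenvalue (map_mx intr S) z -> `|z| <= alpha%:C.

(* The polynomial p below is the minimal polynomial of a over Q; its complex
   roots other than a are the conjugates of a. *)
Definition salem_number (R : realType) (a : R) : Prop :=
  1 < a /\
  exists p : {poly int},
    [/\ p \is monic, irreducible_poly (map_poly (intr : int -> rat) p),
        root (map_poly intr p) a,
        forall z : R[i], root (map_poly intr p) z -> z != a%:C -> `|z| <= 1 &
        exists z : R[i], root (map_poly intr p) z /\ `|z| = 1].

Definition salem_type (R : realType) n (zeta : substitution n) : Prop :=
  irreducible_char_poly zeta /\
  exists alpha : R, perron_frobenius_eigenvalue (subst_mx zeta) alpha /\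
    salem_number alpha.

(* w \in Q(alpha) *)
Definition in_Q_adjoin (R : realType) (alpha w : R) : Prop :=
  exists p q : {poly rat}, (map_poly ratr q).[alpha] != 0 /\
    w = (map_poly ratr p).[alpha] / (map_poly ratr q).[alpha].

Definition Cintegral (R : realType) d (T : measurableType d)
    (mu : {measure set T -> \bar R}) (D : set T) (f : T -> R[i]) : R[i] :=
  (\int[mu]_(x in D) complex.Re (f x))%R +i*
  (\int[mu]_(x in D) complex.Im (f x))%R.

(* Functions on subst_space zeta are represented by functions on the ambient
   space of sequences, whose values outside subst_space zeta are ignored. *)
Definition cylindrical0 (R : realType) n (zeta : substitution n)
    (f : borel_seq_space n -> R[i]) : Prop :=
  forall x y, subst_space zeta x -> subst_space zeta y ->
    x 0 = y 0 -> f x = f y.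

Definition L2_inner (R : realType) n (zeta : substitution n)
    (mu : probability (borel_seq_space n) R)
    (f g : borel_seq_space n -> R[i]) : R[i] :=
  Cintegral mu (subst_space zeta) (fun x => f x * (g x)^*).

(* Also the total mass of the spectral measure of f. *)
Definition L2_normsq (R : realType) n (zeta : substitution n)
    (mu : probability (borel_seq_space n) R)
    (f : borel_seq_space n -> R[i]) : R :=
  complex.Re (L2_inner zeta mu f f).

(* R/Z is represented by [0, 1[. *)
Definition spectral_measure (R : realType) n (zeta : substitution n)
    (mu : probability (borel_seq_space n) R)
    (f : borel_seq_space n -> R[i])
    (sigma : {finite_measure set (measurableTypeR R) -> \bar R}) : Prop :=
  sigma (~` `[0, 1[%classic) = 0%E /\
  forall k : int,
    Cintegral sigma `[0, 1[%classic
      (fun w => cos (2 * pi * k%:~R * w) +i* sin (2 * pi * k%:~R * w)) =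
    L2_inner zeta mu (f \o shift_seq k) f.

Definition circle_ball (R : realType) (w r : R) : set (measurableTypeR R) :=
  [set x : R | 0 <= x < 1 /\ exists m : int, `|x - w - m%:~R| < r].

(* Main.v *)
Require Import Defs.
From mathcomp Require Import all_boot all_order all_algebra.
From mathcomp Require Import separable qpoly.
From mathcomp Require Import all_classical all_reals all_analysis.
From mathcomp Require Import complex.
From mathcomp Require Import measurable_realfun.
From mathcomp Require Import zify ring lra.
Local Open Scope classical_set_scope.
Local Open Scope ring_scope.

(** By the Fejer kernel, [sigma_f (B_r w)] is bounded by the normalized L2 norm
    of a twisted Birkhoff sum of length N ~ 1/r, so it suffices to save a power
    of N in the twisted sums of words of the language.  Such a sum over
    [zeta^k(a)] is compared with the length of [zeta^k(a)]: whenever a return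
    word v has [|zeta^k(v)| w] far from the integers, two occurrences of the
    same block partially cancel and the ratio drops by a fixed factor.

    For [w = g(alpha)], the sequence [w |zeta^k(v)|] is, modulo a sequence with
    bounded denominators obeying the recurrence of [alpha], a bounded
    sequence.  If it stayed close to the integers along a long window, a
    bounded integer solution of the recurrence would repeat a state and hence
    vanish, so the bounded part itself would be small on the window.  Its
    components along the conjugates z of modulus 1 do not decay, which forces
    [g(z) = w] for all of them; since the minimal polynomial is reciprocal, w is
    then rational and [w |v|] is an integer.  Finally some return word has [w |v|]
    not an integer: otherwise w times the position, modulo 1, would be a
    function of the letter, giving a nonzero integer row vector with bounded
    orbit under the substitution matrix, against irreducibility. *)

Set Implicit Arguments.
Unset Strict Implicit.
Unset Printing Implicit Defensive.
Import Order.TTheory GRing.Theory Num.Theory.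
Import numFieldNormedType.Exports.
Local Open Scope complex_scope.

(** * Polynomials acting on sequences *)

Notation pQ := (map_poly (intr : int -> rat)).

Lemma map_poly_ratr_intr (F : numFieldType) (p : {poly int}) :
  map_poly (ratr : rat -> F) (pQ p) = map_poly intr p.
Proof.
by rewrite -map_poly_comp; apply: eq_map_poly => z /=; rewrite ratr_int.
Qed.

(** A common root rules out coprimality, and [p] is irreducible. Together with the converse below,
    this carries a rational identity from one root of [p] to all of them, in the role of Galois
    conjugation. *)
Lemma irreducible_dvdp_root (F : numFieldType) (p : {poly int})
    (q : {poly rat}) (z : F) :
  irreducible_poly (pQ p) -> root (map_poly intr p) z ->
  root (map_poly ratr q) z -> pQ p %| q.
Proof.
move=> irp pz qz; apply/negPn/negP; rewrite -(irreducible_poly_coprime q irp).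
rewrite -(coprimep_map (ratr : {rmorphism rat -> F})).
rewrite map_poly_ratr_intr => /coprimep_root /(_ pz).
by rewrite -rootE qz.
Qed.

Lemma dvdp_root_ratr (F : numFieldType) (p : {poly int})
    (q : {poly rat}) (z : F) :
  pQ p %| q -> root (map_poly intr p) z -> root (map_poly ratr q) z.
Proof.
move=> pq pz; rewrite -map_poly_ratr_intr in pz.
by have /dvdpP[c ->] := pq; rewrite rmorphM /= rootM pz orbT.
Qed.

(** One root of [p] at which [q] does not vanish shows that [p] does not divide [q]; the two are
    then coprime and Bezout inverts [q] modulo [p]. *)
Lemma inverse_mod_irreducible (F : numFieldType) (p : {poly int})
    (q : {poly rat}) (z : F) :
  irreducible_poly (pQ p) -> root (map_poly intr p) z ->
  ~~ root (map_poly ratr q) z -> exists v, pQ p %| v * q - 1.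
Proof.
move=> irp pz nqz.
have cop : coprimep (pQ p) q.
  rewrite (irreducible_poly_coprime q irp); apply/negP => pq.
  by move/negP: nqz; apply; exact: dvdp_root_ratr pq pz.
have [[u v] /= uv1] := Bezout_eq1_coprimepP (pQ p) q cop.
exists v; rewrite -uv1 opprD addrCA subrr addr0 -mulNr.
exact: dvdp_mulIr.
Qed.

(** The action of polynomials on sequences where ['X] is the shift: [s] obeys the linear recurrence
    with characteristic polynomial [p] when [poly_act p s] vanishes. *)
Definition poly_act (F : comNzRingType) (p : {poly F}) (s : nat -> F) (k : nat) : F :=
  \sum_(i < size p) p`_i * s (k + i)%N.

Lemma poly_actE (F : comNzRingType) (p : {poly F}) (s : nat -> F) k n :
  (size p <= n)%N -> poly_act p s k = \sum_(i < n) p`_i * s (k + i)%N.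
Proof.
move=> pn; rewrite /poly_act -!(big_mkord xpredT (fun i => p`_i * s (k + i)%N)).
rewrite [RHS](@big_cat_nat _ _ _ (size p)) //=.
rewrite -[LHS]addr0; congr (_ + _); rewrite big_nat_cond big1// => i.
by move=> /andP[/andP[pi _] _]; rewrite nth_default ?mul0r.
Qed.

Lemma poly_actD (F : comNzRingType) (p q : {poly F}) (s : nat -> F) k :
  poly_act (p + q) s k = poly_act p s k + poly_act q s k.
Proof.
rewrite (@poly_actE _ (p + q) _ _ (maxn (size p) (size q))) ?size_polyD//.
rewrite (@poly_actE _ p _ _ (maxn (size p) (size q))) ?leq_maxl//.
rewrite (@poly_actE _ q _ _ (maxn (size p) (size q))) ?leq_maxr//.
by rewrite -big_split /=; apply: eq_bigr => i _; rewrite coefD mulrDl.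
Qed.

Lemma poly_actC (F : comNzRingType) (c : F) (s : nat -> F) k :
  poly_act c%:P s k = c * s k.
Proof.
by rewrite (@poly_actE _ _ _ _ 1) ?size_polyC_leq1// big_ord1 coefC eqxx addn0.
Qed.

Lemma poly_act0 (F : comNzRingType) (s : nat -> F) k : poly_act 0 s k = 0.
Proof. by rewrite /poly_act size_poly0 big_ord0. Qed.

Lemma poly_actMX (F : comNzRingType) (p : {poly F}) (s : nat -> F) k :
  poly_act (p * 'X) s k = poly_act p s k.+1.
Proof.
rewrite (@poly_actE _ (p * 'X) _ _ (size p).+1); last first.
  have [->|p0] := eqVneq p 0; first by rewrite mul0r size_poly0.
  by rewrite size_mulX.
rewrite big_ord_recl coefMX eqxx mul0r add0r; apply: eq_bigr => i _.
by rewrite coefMX /= /bump leq0n add1n addSnnS.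
Qed.

Lemma poly_actM (F : comNzRingType) (p q : {poly F}) (s : nat -> F) k :
  poly_act (p * q) s k = poly_act p (poly_act q s) k.
Proof.
elim/poly_ind: p k => [|p c IH] k; first by rewrite mul0r !poly_act0.
rewrite mulrDl mulrAC !poly_actD !poly_actMX IH; congr (_ + _).
rewrite poly_actC {1}/poly_act mul_polyC.
rewrite -/(poly_act _ _ _) (@poly_actE _ _ _ _ (size q)) ?size_scale_leq//.
by rewrite /poly_act mulr_sumr; apply: eq_bigr => i _; rewrite coefZ mulrA.
Qed.

Lemma poly_actCA (F : comNzRingType) (p q : {poly F}) (s : nat -> F) k :
  poly_act p (poly_act q s) k = poly_act q (poly_act p s) k.
Proof. by rewrite -!poly_actM mulrC. Qed.

Lemma poly_act_sum (F : comNzRingType) (I : Type) (r : seq I)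
    (p : I -> {poly F}) (s : nat -> F) k :
  poly_act (\sum_(i <- r) p i) s k = \sum_(i <- r) poly_act (p i) s k.
Proof.
elim: r => [|i r IH]; first by rewrite !big_nil poly_act0.
by rewrite !big_cons poly_actD IH.
Qed.

Lemma poly_act_comb (F : comNzRingType) (p : {poly F}) (a b : F)
    (s t : nat -> F) k :
  poly_act p (fun i => a * s i + b * t i) k = a * poly_act p s k + b * poly_act p t k.
Proof.
rewrite /poly_act !mulr_sumr -big_split; apply: eq_bigr => i _ /=.
by rewrite mulrDr mulrCA; congr (_ + _); rewrite mulrCA.
Qed.

Lemma eq_poly_act (F : comNzRingType) (p : {poly F}) (s t : nat -> F) :
  s =1 t -> poly_act p s =1 poly_act p t.
Proof. by move=> st k; apply: eq_bigr => i _; rewrite st. Qed.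

Lemma poly_act_map (F G : comNzRingType) (f : {rmorphism F -> G})
    (p : {poly F}) (s : nat -> F) k :
  poly_act (map_poly f p) (f \o s) k = f (poly_act p s k).
Proof.
rewrite (@poly_actE _ _ _ _ (size p)) ?size_poly// rmorph_sum.
by apply: eq_bigr => i _; rewrite coef_map rmorphM.
Qed.

(** The sequence [poly_act p s] is killed by ['X - z], so each term is [z] times the previous
    one. *)
Lemma poly_act_geo (F : comNzRingType) (p : {poly F}) (z : F) (s : nat -> F) k :
  (forall k, poly_act (('X - z%:P) * p) s k = 0) ->
  poly_act p s k = z ^+ k * poly_act p s 0.
Proof.
move=> h; elim: k => [|k IH]; first by rewrite expr0 mul1r.
have := h k; rewrite mulrBl poly_actD [X in poly_act X](mulrC 'X) poly_actMX.
rewrite -mulNr -polyCN poly_actM poly_actC mulNr => /eqP; rewrite subr_eq0.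
by move=> /eqP ->; rewrite IH exprS mulrA.
Qed.

Lemma poly_act_expgeo (F : comNzRingType) (p : {poly F}) (z c : F) (k : nat) :
  poly_act p (fun i => z ^+ i * c) k = p.[z] * (z ^+ k * c).
Proof.
rewrite horner_coef mulr_suml; apply: eq_bigr => i _.
by rewrite exprD -!mulrA; congr (_ * _); rewrite mulrCA.
Qed.

(** * Bounded integer solutions of a recurrence *)

Lemma pigeonhole_nat (T : finType) (f : nat -> T) :
  exists a b : nat, [/\ (a < b)%N, (b <= #|T|)%N & f a = f b].
Proof.
have /injectivePn[x [y xy fxy]] : ~~ injectiveb (fun i : 'I_#|T|.+1 => f i).
  by apply/negP => /injectiveP /leq_card; rewrite card_ord ltnn.
have xy' : (val x != val y) by [].
case: (ltngtP x y) xy' => // [lt|lt] _.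
  by exists x, y; split=> //; rewrite -ltnS.
by exists y, x; split=> //; rewrite -ltnS.
Qed.

(** A state is a window of [d] consecutive values. Bounded integer states are finite in number, so
    two of them, at times [a < b], coincide. The solution is then killed by ['X^b - 'X^a], which is
    invertible modulo [p] because [alpha > 1] is not one of its roots. *)
Lemma bounded_recurrence_eq0 (F : numFieldType) (p : {poly int}) (alpha : F)
    (B : nat) :
  p \is monic -> irreducible_poly (pQ p) ->
  root (map_poly intr p) alpha -> 1 < alpha ->
  exists2 L : nat, (size p <= L)%N & forall m : nat -> int,
    (forall k, (k + (size p).-1 < L)%N -> poly_act p m k = 0) ->
    (forall k, (k < L)%N -> `|m k| <= B%:Z) -> forall k, (k < L)%N -> m k = 0.
Proof.
move=> pm irp pa a1.
set d := (size p).-1; pose T := {ffun 'I_d -> 'I_(B + B).+1}.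
have szp : size p = d.+1 by rewrite /d prednK// size_poly_gt0 monic_neq0.
(* The pigeonhole finds two equal states starting at most at [#|T|]; this length contains both
   windows. *)
exists (d + #|T|.+1)%N => [|m mrec mB]; first by rewrite szp addnS ltnS leq_addr.
pose P := pQ p.
have szP : size P = d.+1 by rewrite size_map_poly_id0 ?szp// (monicP pm).
have P0 : P != 0 by rewrite -size_poly_gt0 szP.
(* Linear form on the polynomials modulo p sending 'X^k to m k. *)
pose lam (q : {poly rat}) := \sum_(i < d) (q %% P)`_i * (m i)%:~R.
have lamD q r : lam (q + r) = lam q + lam r.
  rewrite /lam -big_split; apply: eq_bigr => i _ /=.
  by rewrite modpD coefD mulrDl.
have lamZ c q : lam (c *: q) = c * lam q.
  rewrite /lam mulr_sumr; apply: eq_bigr => i _ /=.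
  by rewrite modpZl coefZ mulrA.
have lam0 : lam 0 = 0 by rewrite -(scale0r 0) lamZ mul0r.
have lam_sum n (c : nat -> rat) (q : nat -> {poly rat}) :
    lam (\sum_(i < n) c i *: q i) = \sum_(i < n) c i * lam (q i).
  elim: n => [|n IH]; first by rewrite !big_ord0 lam0.
  by rewrite !big_ord_recr /= lamD lamZ IH.
have lamMP q : lam (q * P) = 0.
  by rewrite /lam big1// => i _; rewrite modp_mull coef0 mul0r.
have lamX k : (k < d + #|T|.+1)%N -> lam 'X^k = (m k)%:~R.
  elim/ltn_ind: k => k IH kL.
  have [kd|dk] := ltnP k d.
    rewrite /lam modp_small ?size_polyXn ?szP//.
    rewrite (bigD1 (Ordinal kd)) //= coefXn eqxx mul1r big1 ?addr0// => i ik.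
    by rewrite coefXn -(inj_eq val_inj) in ik *; rewrite /= (negPf ik) mul0r.
  have := lamMP 'X^(k - d); rewrite -[P in _ * P]coefK szP poly_def mulr_sumr.
  have -> : \sum_(i < d.+1) 'X^(k - d) * (P`_i *: 'X^i) =
      \sum_(i < d.+1) P`_i *: 'X^(k - d + i).
    by apply: eq_bigr => i _; rewrite -scalerAr exprD.
  rewrite (lam_sum _ (nth 0 P) (fun i => 'X^(k - d + i))) big_ord_recr /=.
  have Pd : P`_d = 1.
    by rewrite coef_map /= /d -[X in X%:~R]/(lead_coef p) (monicP pm).
  rewrite Pd mul1r subnK// => e1.
  have := mrec (k - d)%N; rewrite subnK// => /(_ kL) /(congr1 (intr : int -> rat)).
  rewrite /poly_act szp big_ord_recr /= -[p`_d]/(lead_coef p) (monicP pm) mul1r.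
  rewrite subnK// rmorph0 rmorphD rmorph_sum /= => e2.
  apply: (@addrI _ (\sum_(i < d) P`_i * lam 'X^(k - d + i))).
  rewrite [LHS]e1 -[LHS]e2; congr (_ + _); apply: eq_bigr => i _.
  rewrite coef_map rmorphM /= IH//; first by have := ltn_ord i; lia.
  by have := ltn_ord i; lia.
(* Adding [B] moves the entries of a state into the range from 0 to [2 B], where [inord] is
   faithful. *)
pose st (k : nat) : T := [ffun i : 'I_d => inord (absz (m (k + i)%N + B%:Z))].
have [a [b [ab bT stab]]] := pigeonhole_nat st.
have biL (i : nat) : (i < d)%N -> (b + i < d + #|T|.+1)%N.
  by move=> id_; rewrite addnC -addSn leq_add// leqW.
have aiL (i : nat) : (i < d)%N -> (a + i < d + #|T|.+1)%N.
  by move=> /biL; apply: leq_ltn_trans; rewrite leq_add2r ltnW.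
have mab (i : nat) : (i < d)%N -> m (a + i)%N = m (b + i)%N.
  move=> id_; move/ffunP: stab => /(_ (Ordinal id_)); rewrite !ffunE /=.
  have [ha hb] := (aiL _ id_, biL _ id_).
  move: (mB _ ha) (mB _ hb); rewrite !ler_norml => /andP[h1 h2] /andP[h3 h4].
  by move=> /(congr1 val); rewrite /= !inordK; lia.
pose q : {poly rat} := 'X^b - 'X^a.
have nqa : ~~ root (map_poly ratr q) alpha.
  rewrite rmorphB /= !map_polyXn rootE !hornerE subr_eq0.
  by rewrite (inj_eq (ieexprIn (lt_trans ltr01 a1) _)) ?gt_eqF.
have [v vq] := inverse_mod_irreducible irp pa nqa.
(* Reducing [r] modulo [P] leaves only exponents below [d], for which the equality of the two states
   applies. *)
have lamMq r : lam (r * q) = 0.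
  have -> : lam (r * q) = lam ((r %% P) * q).
    by rewrite /lam [_ %% P * q]mulrC modp_mul mulrC.
  rewrite -[(r %% P)]coefK poly_def mulr_suml.
  have -> : \sum_(i < size (r %% P)) (r %% P)`_i *: 'X^i * q =
    \sum_(i < size (r %% P)) (r %% P)`_i *: ('X^(b + i) - 'X^(a + i)).
    apply: eq_bigr => i _; rewrite -scalerAl /q mulrBr -!exprD.
    by rewrite [(i + b)%N]addnC [(i + a)%N]addnC.
  rewrite (lam_sum _ (nth 0 (r %% P)) (fun i => 'X^(b + i) - 'X^(a + i))) big1// => i _.
  have id_ : (i < d)%N.
    have := ltn_modp r P; rewrite P0 szP ltnS => h.
    exact: leq_trans (ltn_ord i) h.
  rewrite lamD -scaleN1r lamZ !lamX ?aiL ?biL//.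
  by rewrite (mab _ id_) mulN1r subrr mulr0.
(* By Bezout ['X^k] lies in the ideal generated by [q] and [P], on which [lam] vanishes. *)
move=> k kL; apply: (@intr_inj rat); rewrite -lamX// rmorph0.
have /dvdpP[c hc] := vq.
have -> : 'X^k = ('X^k * v) * q + (- 'X^k * c) * P.
  rewrite -(mulrA (- _)) -[c * P]hc -mulrA mulNr -mulrBr.
  by rewrite opprB addrC subrK mulr1.
by rewrite lamD lamMq lamMP addr0.
Qed.

(** * Recurrences and their spectral decomposition *)

(* The quotient of p by 'X - z at a root z.  Its coefficients are polynomials in
   z over the coefficients of p, which gives quot_XsubC_act_neq0. *)
Definition quot_XsubC (F : comNzRingType) (p : {poly F}) (z : F) : {poly F} :=
  \poly_(i < (size p).-1) (drop_poly i.+1 p).[z].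

Lemma coef_quot_XsubC (F : comNzRingType) (p : {poly F}) (z : F) i :
  (quot_XsubC p z)`_i = (drop_poly i.+1 p).[z].
Proof.
rewrite coef_poly; case: ltnP => // h.
by rewrite drop_poly_eq0 ?horner0//; lia.
Qed.

Lemma horner_drop_poly (F : comNzRingType) (p : {poly F}) (z : F) i :
  (drop_poly i p).[z] = p`_i + z * (drop_poly i.+1 p).[z].
Proof.
have -> : drop_poly i p = (p`_i)%:P + drop_poly i.+1 p * 'X.
  apply/polyP => -[|j]; rewrite coefD coefC coefMX !coef_drop_poly /=.
    by rewrite addr0.
  by rewrite add0r addnS addSn.
by rewrite hornerD hornerC hornerMX mulrC.
Qed.

Lemma mul_quot_XsubC (F : comNzRingType) (p : {poly F}) (z : F) :
  root p z -> ('X - z%:P) * quot_XsubC p z = p.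
Proof.
move=> pz; apply/polyP => i; rewrite mulrBl coefB mul_polyC coefZ mulrC coefMX.
rewrite !coef_quot_XsubC; case: i => [|i] /=.
  have := horner_drop_poly p z 0; rewrite drop_poly0l (rootP pz) sub0r => /eqP.
  by rewrite eq_sym addr_eq0 => /eqP.
by rewrite horner_drop_poly addrK.
Qed.

Lemma quot_XsubC_geo (F : comNzRingType) (p : {poly F}) (z : F) (s : nat -> F) k :
  root p z -> (forall k, poly_act p s k = 0) ->
  poly_act (quot_XsubC p z) s k = z ^+ k * poly_act (quot_XsubC p z) s 0.
Proof.
by move=> pz ps; apply: poly_act_geo => j; rewrite mul_quot_XsubC.
Qed.

(** On the component along [z], which is geometric of ratio [z], the operator [poly_act g] is
    multiplication by [g.[z]]. *)
Lemma quot_XsubC_twist (F : comNzRingType) (p g : {poly F}) (z w : F)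
    (s : nat -> F) k :
  root p z -> (forall k, poly_act p s k = 0) ->
  poly_act (quot_XsubC p z) (fun i => w * s i - poly_act g s i) k =
  z ^+ k * ((w - g.[z]) * poly_act (quot_XsubC p z) s 0).
Proof.
move=> pz ps; set P := quot_XsubC p z.
have -> : poly_act P (fun i => w * s i - poly_act g s i) k =
    w * poly_act P s k + (-1) * poly_act P (poly_act g s) k.
  rewrite -poly_act_comb; apply: eq_poly_act => i.
  by rewrite mulN1r.
rewrite poly_actCA (eq_poly_act _ (fun i => quot_XsubC_geo i pz ps)) -/P.
by rewrite poly_act_expgeo quot_XsubC_geo// -/P; ring.
Qed.

(** As a polynomial in [z] the value is [Q.[z]], where [Q] has degree below that of [p]. Only the
    term [i = 0] reaches degree [d - 1], with coefficient [u 0], so [Q] is nonzero and the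
    irreducible [p] cannot divide it. *)
Lemma quot_XsubC_act_neq0 (F : numFieldType) (p : {poly int}) (z : F)
    (u : nat -> int) :
  p \is monic -> irreducible_poly (pQ p) -> root (map_poly intr p) z ->
  u 0%N != 0 ->
  poly_act (quot_XsubC (map_poly intr p) z) (fun k => (u k)%:~R) 0 != 0.
Proof.
move=> pm irp pz u0; set pF := map_poly _ p.
set d := (size p).-1.
have d0 : (0 < d)%N.
  by have := irp.1; rewrite size_map_poly_id0 ?(monicP pm)// /d; case: (size p).
have szp : size p = d.+1 by rewrite /d prednK// size_poly_gt0 monic_neq0.
have szpF : size pF = d.+1 by rewrite size_map_poly_id0 ?szp// (monicP pm) oner_eq0.
pose Q : {poly int} := \sum_(i < d) u i *: drop_poly i.+1 p.
have -> : poly_act (quot_XsubC pF z) (fun k => (u k)%:~R) 0 = (map_poly intr Q).[z].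
  rewrite (@poly_actE _ _ _ _ d); last by rewrite -[d]/(d.+1.-1) -szpF size_poly.
  rewrite rmorph_sum horner_sum; apply: eq_bigr => i _.
  rewrite add0n coef_quot_XsubC /= map_polyZ hornerZ mulrC; congr (_ * _.[_]).
  by apply/polyP => j; rewrite !(coef_drop_poly, coef_map).
have szQ : (size Q <= d)%N.
  apply: (leq_trans (size_sum _ _ _)); apply/bigmax_leqP => i _.
  by rewrite (leq_trans (size_scale_leq _ _))// size_drop_poly szp subSS leq_subr.
have Q0 : Q != 0.
  apply: contraNneq u0 => /(congr1 (fun q : {poly int} => q`_d.-1)).
  rewrite coef0 coef_sum (bigD1 (Ordinal d0)) //= big1 => [|i i0].
    rewrite addr0 coefZ coef_drop_poly addn1 prednK//.
    by rewrite -[p`_d]/(lead_coef p) (monicP pm) mulr1 => ->.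
  rewrite coefZ coef_drop_poly nth_default ?mulr0// szp.
  have : (val i != 0)%N by [].
  by rewrite -lt0n => i1; rewrite addnS -addSn prednK// -addn1 leq_add2l.
apply/negP => /eqP Qz.
have /(irreducible_dvdp_root irp pz) : root (map_poly ratr (pQ Q)) z.
  by rewrite map_poly_ratr_intr rootE Qz.
move=> /dvdp_leq; rewrite !size_rat_int_poly -size_poly_eq0 size_rat_int_poly.
by rewrite size_poly_eq0 szp => /(_ Q0); rewrite leqNgt ltnS szQ.
Qed.

(** In characteristic 0 the derivative is nonzero of smaller degree, hence not divisible by [p]. *)
Lemma irreducible_separable (p : {poly rat}) :
  irreducible_poly p -> separable_poly p.
Proof.
move=> irp; rewrite unlock irreducible_poly_coprime//.
have sz := irp.1; set d := (size p).-1.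
have szp : size p = d.+1 by rewrite /d; case: (size p) sz.
apply/negP => /dvdp_leq h.
have d0 : (0 < d)%N by rewrite -ltnS -szp.
have p0 := irredp_neq0 irp.
have p'0 : p^`() != 0.
  apply/eqP => /(congr1 (fun q : {poly rat} => q`_d.-1)).
  rewrite coef0 coef_deriv prednK// => /eqP; rewrite mulrn_eq0 eqn0Ngt d0 /=.
  by rewrite -[p`_d]/(lead_coef p) lead_coef_eq0 (negPf p0).
by have := h p'0; rewrite leqNgt lt_size_deriv.
Qed.

Lemma irreducible_roots (F : numClosedFieldType) (p : {poly int}) :
  p \is monic -> irreducible_poly (pQ p) ->
  exists rs : seq F, [/\ uniq rs, size p = (size rs).+1 &
    map_poly intr p = \prod_(z <- rs) ('X - z%:P)].
Proof.
move=> pm irp; set pF : {poly F} := map_poly intr p.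
have [rs rsE] := closed_field_poly_normal pF.
have lc : lead_coef pF = 1.
  by rewrite lead_coef_map_eq ?(monicP pm) ?rmorph1 ?oner_eq0.
rewrite lc scale1r in rsE; exists rs; split => //.
- rewrite -separable_prod_XsubC -rsE /pF -map_poly_ratr_intr separable_map.
  exact: irreducible_separable.
- rewrite -(size_prod_XsubC rs id) -rsE size_map_poly_id0//.
  by rewrite (monicP pm) oner_eq0.
Qed.

Lemma quot_XsubC_root (F : idomainType) (p : {poly F}) (y z : F) :
  root p z -> root p y -> y != z -> (quot_XsubC p z).[y] = 0.
Proof.
move=> pz py yz; have := mul_quot_XsubC pz => /(congr1 (horner^~ y)).
rewrite hornerM (rootP py) hornerXsubC => /eqP; rewrite mulf_eq0 subr_eq0.
by rewrite (negPf yz) => /eqP.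
Qed.

Lemma quot_XsubC_horner_neq0 (F : idomainType) (rs : seq F) (p := \prod_(z <- rs) ('X - z%:P)) (z : F) :
  uniq rs -> z \in rs -> (quot_XsubC p z).[z] != 0.
Proof.
move=> urs zrs; have pz : root p z by rewrite /p root_prod_XsubC.
have : p = ('X - z%:P) * \prod_(y <- rem z rs) ('X - y%:P).
  by rewrite /p (perm_big _ (perm_to_rem zrs)) /= big_cons.
rewrite -{1}(mul_quot_XsubC pz) => /mulfI -> //.
  rewrite -rootE root_prod_XsubC mem_rem_uniqF//.
by rewrite polyXsubC_eq0.
Qed.

(* Lagrange interpolation of 1 at the simple roots of p, applied to s. *)
Lemma recurrence_spectral (F : fieldType) (rs : seq F)
    (p := \prod_(z <- rs) ('X - z%:P)) (s : nat -> F) k :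
  uniq rs -> (forall k, poly_act p s k = 0) ->
  s k = \sum_(z <- rs) (quot_XsubC p z).[z]^-1 *
    (z ^+ k * poly_act (quot_XsubC p z) s 0).
Proof.
move=> urs ps.
have szp : size p = (size rs).+1 by rewrite /p size_prod_XsubC.
have pr z : z \in rs -> root p z by rewrite /p root_prod_XsubC.
have [rs0|rs0] := posnP (size rs).
  have rsN : rs = [::] by case: (rs) rs0.
  have := ps k; rewrite /p rsN !big_nil -[1]/(1%:P) poly_actC mul1r => ->.
  by [].
have -> : s k = poly_act 1 s k by rewrite -[1]/(1%:P) poly_actC mul1r.
have one : 1 = \sum_(z <- rs) (quot_XsubC p z).[z]^-1%:P * quot_XsubC p z.
  apply/eqP; rewrite -subr_eq0; apply/eqP.
  apply: (@roots_geq_poly_eq0 _ _ rs) => //.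
    apply/allP => y yrs; rewrite rootE !hornerE horner_sum.
    rewrite (bigD1_seq y)//= hornerM hornerC mulVf ?quot_XsubC_horner_neq0//.
    rewrite big_seq_cond big1 ?addr0 ?subrr// => z /andP[zrs zy].
    rewrite eq_sym in zy.
    by rewrite hornerM (quot_XsubC_root (pr _ zrs) (pr _ yrs) zy) mulr0.
  rewrite (leq_trans (size_polyD _ _))// geq_max size_poly1 rs0 size_polyN.
  rewrite (leq_trans (size_sum _ _ _))//; apply/bigmax_leqP_seq => z zrs _.
  rewrite mul_polyC (leq_trans (size_scale_leq _ _))//.
  by rewrite (leq_trans (size_poly _ _))// szp.
rewrite [in LHS]one poly_act_sum big_seq [RHS]big_seq; apply: eq_bigr => z zrs.
by rewrite poly_actM poly_actC quot_XsubC_geo// pr.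
Qed.

(** * Salem numbers *)

(** Inverting ['X] modulo [p] gives a single rational polynomial that inverts every root, so that
    statements about [z^-1] become divisibilities by [p]. *)
Lemma inverse_root (F : numFieldType) (p : {poly int}) (alpha : F) :
  irreducible_poly (pQ p) -> root (map_poly intr p) alpha -> alpha != 0 ->
  exists a : {poly rat}, forall (G : numFieldType) (z : G),
    root (map_poly intr p) z -> z != 0 /\ (map_poly ratr a).[z] = z^-1.
Proof.
move=> irp pa a0.
have nX : ~~ root (map_poly ratr ('X : {poly rat})) alpha.
  by rewrite map_polyX rootX.
have [a pdiv] := inverse_mod_irreducible irp pa nX.
exists a => G z pz; have := dvdp_root_ratr pdiv pz.
rewrite rmorphB rmorphM rmorph1 /= map_polyX rootE !hornerE subr_eq0 => /eqP az.
have z0 : z != 0.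
  by apply: contra_eq_neq az => ->; rewrite mulr0 eq_sym oner_eq0.
by split => //; apply: (mulIf z0); rewrite az mulVf.
Qed.

Lemma normc_eq1_inv (R : rcfType) (z : R[i]) : `|z| = 1 -> z^-1 = z^*.
Proof. by move=> z1; rewrite invc_norm z1 expr1n invr1 mul1r. Qed.

Lemma root_conjc (R : rcfType) (p : {poly int}) (z : R[i]) :
  root (map_poly intr p) z -> root (map_poly intr p) z^*.
Proof.
move=> pz; rewrite -complex_root_conj -map_poly_comp.
by rewrite (eq_map_poly (g := intr)) // => x /=; rewrite rmorph_int.
Qed.

Lemma root_real_complex (R : rcfType) (p : {poly int}) (x : R) :
  root (map_poly intr p) x%:C = root (map_poly intr p) x.
Proof.
have -> : map_poly intr p = map_poly (real_complex R) (map_poly intr p).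
  by rewrite -map_poly_comp; apply: eq_map_poly => z /=; rewrite rmorph_int.
by rewrite fmorph_root.
Qed.

Section Salem.
Variables (R : realType) (p : {poly int}) (alpha : R).
Hypotheses (pm : p \is monic) (irp : irreducible_poly (pQ p))
  (pa : root (map_poly intr p) alpha) (a1 : 1 < alpha)
  (pz_le1 : forall z : R[i], root (map_poly intr p) z -> z != alpha%:C -> `|z| <= 1)
  (pz_eq1 : exists z : R[i], root (map_poly intr p) z /\ `|z| = 1).

(** For a root [y] of modulus 1 the inverse is the complex conjugate, again a root. Hence [p]
    divides [pQ p \Po a], which expresses the same fact at every root. *)
Lemma salem_root_inv (z : R[i]) :
  root (map_poly intr p) z -> root (map_poly intr p) z^-1.
Proof.
have a0 : alpha != 0 by rewrite gt_eqF// (lt_trans ltr01).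
have [a aE] := inverse_root irp pa a0.
have comp (y : R[i]) : root (map_poly intr p) y ->
    root (map_poly ratr (pQ p \Po a)) y = root (map_poly intr p) y^-1.
  move=> py; rewrite map_comp_poly map_poly_ratr_intr !rootE horner_comp.
  by rewrite (aE _ _ py).2.
have [y [py y1]] := pz_eq1; move=> pz; rewrite -comp//.
apply: (dvdp_root_ratr _ pz); apply: (irreducible_dvdp_root irp py).
by rewrite comp// normc_eq1_inv//; exact: root_conjc.
Qed.

(** Both [z] and [z^-1] are roots different from [alpha], so both have modulus at most 1. *)
Lemma salem_root_norm (z : R[i]) : root (map_poly intr p) z ->
  z != alpha%:C -> z != alpha%:C^-1 -> `|z| = 1.
Proof.
move=> pz za zV; apply/eqP; rewrite eq_le pz_le1//=.
have : `|z^-1| <= 1.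
  by apply: pz_le1 (salem_root_inv pz) _; rewrite (can2_eq (@invrK _) (@invrK _)).
rewrite normfV invf_le1// normr_gt0.
have a0 : alpha != 0 by rewrite gt_eqF// (lt_trans ltr01).
by have [b bE] := inverse_root irp pa a0; exact: (bE _ _ pz).1.
Qed.

(** The roots left to treat are [alpha] and [alpha^-1]. The identity [g.[y^-1] = g.[y]] holds at a
    root of modulus 1, hence at all roots, and at [alpha] it gives the value at [alpha^-1]. *)
Lemma salem_rational_value (g : {poly rat}) (w : R) :
  (map_poly ratr g).[alpha] = w ->
  (forall z : R[i], root (map_poly intr p) z -> `|z| = 1 ->
    (map_poly ratr g).[z] = w%:C) ->
  forall z : R[i], root (map_poly intr p) z -> (map_poly ratr g).[z] = w%:C.
Proof.
move=> gaR gz.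
have a0 : alpha != 0 by rewrite gt_eqF// (lt_trans ltr01).
have [a aE] := inverse_root irp pa a0.
have ga : (map_poly ratr g).[alpha%:C] = w%:C.
  have -> : map_poly ratr g = map_poly (real_complex R) (map_poly ratr g).
    rewrite -map_poly_comp; apply: eq_map_poly => x /=.
    by rewrite fmorph_rat.
  by rewrite horner_map /= gaR.
have comp (y : R[i]) : root (map_poly intr p) y ->
    root (map_poly ratr (g \Po a - g)) y = ((map_poly ratr g).[y^-1] == (map_poly ratr g).[y]).
  move=> py; rewrite rmorphB /= map_comp_poly rootE !hornerE horner_comp.
  by rewrite (aE _ _ py).2 subr_eq0.
have [y [py y1]] := pz_eq1.
have dv : pQ p %| g \Po a - g.
  apply: (irreducible_dvdp_root irp py); rewrite comp// (gz y)// gz//.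
    exact: salem_root_inv.
  by rewrite normfV y1 invr1.
have gV : (map_poly ratr g).[alpha%:C^-1] = w%:C.
  have ra : root (map_poly intr p) alpha%:C by rewrite root_real_complex.
  by have := dvdp_root_ratr dv ra; rewrite comp// ga => /eqP.
move=> z pz; have [->//|za] := eqVneq z alpha%:C.
have [->//|zV] := eqVneq z alpha%:C^-1.
by apply: gz => //; exact: salem_root_norm.
Qed.

(** Inversion permutes the roots, so the product of the [- z] is equal to its own inverse. *)
Lemma salem_coef0_sqr : p`_0 ^+ 2 = 1.
Proof.
have [rs [urs _ rsE]] := irreducible_roots R[i] pm irp.
have a0 : alpha != 0 by rewrite gt_eqF// (lt_trans ltr01).
have [a aE] := inverse_root irp pa a0.
have pV : perm_eq (map GRing.inv rs) rs.
  apply: uniq_perm => //; first by rewrite map_inj_uniq//; exact: invr_inj.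
  move=> z; rewrite -[z in LHS]invrK mem_map; last exact: invr_inj.
  rewrite -!root_prod_XsubC -rsE; apply/idP/idP => /salem_root_inv//.
  by rewrite invrK.
have p0 : (p`_0)%:~R = \prod_(z <- rs) (- z).
  have -> : (p`_0)%:~R = (map_poly (intr : int -> R[i]) p).[0].
    by rewrite horner_coef0 coef_map.
  by rewrite rsE horner_prod; apply: eq_bigr => z _; rewrite hornerXsubC sub0r.
apply: (@intr_inj R[i]); rewrite rmorphXn /= p0 expr2.
rewrite -{2}(perm_big _ pV) big_map /= -big_split big_seq big1//= => z zrs.
rewrite mulrNN divff//; apply: (aE R[i] z _).1.
by rewrite rsE root_prod_XsubC.
Qed.

End Salem.

(** * The real-valued modulus of a complex number *)

Notation cnorm := Normc.normc.

Lemma cnormE (R : rcfType) (z : R[i]) : (cnorm z)%:C = `|z|.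
Proof. by rewrite normc_def; case: z. Qed.

Lemma cnorm_ge0 (R : rcfType) (z : R[i]) : 0 <= cnorm z.
Proof. by rewrite -ler0c cnormE. Qed.

Lemma cnormM (R : rcfType) (x y : R[i]) : cnorm (x * y) = cnorm x * cnorm y.
Proof. exact: Normc.normcM. Qed.

Lemma cnormX (R : rcfType) (x : R[i]) k : cnorm (x ^+ k) = cnorm x ^+ k.
Proof. by apply: complexI; rewrite rmorphXn /= !cnormE normrX. Qed.

Lemma cnorm_real (R : rcfType) (x : R) : cnorm x%:C = `|x|.
Proof. by rewrite /= expr0n /= addr0 sqrtr_sqr. Qed.

Lemma ler_cnormD (R : rcfType) (x y : R[i]) : cnorm (x + y) <= cnorm x + cnorm y.
Proof. by rewrite -lecR rmorphD /= !cnormE ler_normD. Qed.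

Lemma ler_cnorm_sum (R : rcfType) (I : Type) (r : seq I) (P : pred I) (F : I -> R[i]) :
  cnorm (\sum_(i <- r | P i) F i) <= \sum_(i <- r | P i) cnorm (F i).
Proof.
rewrite -lecR rmorph_sum /= cnormE.
by under [leRHS]eq_bigr do rewrite cnormE; exact: ler_norm_sum.
Qed.

Lemma cnorm_eq0 (R : rcfType) (z : R[i]) : (cnorm z == 0) = (z == 0).
Proof. by rewrite -(inj_eq (@complexI R)) cnormE normr_eq0. Qed.

Lemma cnorm0 (R : rcfType) : cnorm (0 : R[i]) = 0.
Proof. by apply/eqP; rewrite cnorm_eq0. Qed.

(** * Distance of [w * u k] to the integers *)

Section SalemTwist.
Variables (R : realType) (p : {poly int}) (alpha : R).
Hypotheses (pm : p \is monic) (irp : irreducible_poly (pQ p))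
  (pa : root (map_poly intr p) alpha) (a1 : 1 < alpha)
  (pz_le1 : forall z : R[i], root (map_poly intr p) z -> z != alpha%:C -> `|z| <= 1)
  (pz_eq1 : exists z : R[i], root (map_poly intr p) z /\ `|z| = 1).
Variables (g : {poly rat}) (w : R) (u : nat -> int).
Hypotheses (gw : (map_poly ratr g).[alpha] = w)
  (pu : forall k, poly_act p u k = 0).

(** Since [g.[alpha] = w], the subtraction cancels the component of [w * u] along [alpha], the only
    one that may grow; the subtracted sequence has bounded denominators. *)
Let twist k : R := w * (u k)%:~R - poly_act (map_poly ratr g) (fun i => (u i)%:~R) k.

Let pC : {poly R[i]} := map_poly intr p.
Let gC : {poly R[i]} := map_poly ratr g.
Let uC k : R[i] := (u k)%:~R.

Lemma twist_complex k : (twist k)%:C = w%:C * uC k - poly_act gC uC k.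
Proof.
rewrite rmorphB rmorphM /= rmorph_int; congr (_ - _).
rewrite -poly_act_map -map_poly_comp.
rewrite (eq_map_poly (g := ratr)) => [|x /=]; last by rewrite fmorph_rat.
by apply: eq_poly_act => i /=; rewrite rmorph_int.
Qed.

Lemma recurrence_uC k : poly_act pC uC k = 0.
Proof. by rewrite (poly_act_map (intr : {rmorphism int -> R[i]})) pu rmorph0. Qed.

Lemma recurrence_twist k : poly_act pC (fun i => (twist i)%:C) k = 0.
Proof.
rewrite (eq_poly_act _ twist_complex).
rewrite (@eq_poly_act _ _ _ (fun i => w%:C * uC i + (-1) * poly_act gC uC i)).
  rewrite poly_act_comb recurrence_uC mulr0 poly_actCA (eq_poly_act _ recurrence_uC).
  by rewrite /poly_act big1 ?mulr0 ?addr0// => i _; rewrite mulr0.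
by move=> i; rewrite mulN1r.
Qed.

Lemma twist_quot z k : root pC z ->
  poly_act (quot_XsubC pC z) (fun i => (twist i)%:C) k =
  z ^+ k * ((w%:C - gC.[z]) * poly_act (quot_XsubC pC z) uC 0).
Proof.
move=> pz; rewrite (eq_poly_act _ twist_complex).
exact: quot_XsubC_twist pz recurrence_uC.
Qed.

Lemma twist_at_alpha : gC.[alpha%:C] = w%:C.
Proof.
have -> : gC = map_poly (real_complex R) (map_poly ratr g).
  by rewrite -map_poly_comp; apply: eq_map_poly => x /=; rewrite fmorph_rat.
by rewrite horner_map /= gw.
Qed.

(** In the spectral decomposition the coefficient at [alpha] has the factor [w - g.[alpha] = 0], and
    the other roots have modulus at most 1. *)
Lemma twist_bounded : exists2 B : R, 0 <= B & forall k, `|twist k| <= B.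
Proof.
have [rs [urs _ rsE]] := irreducible_roots R[i] pm irp.
pose c z := cnorm (quot_XsubC pC z).[z]^-1 *
  cnorm ((w%:C - gC.[z]) * poly_act (quot_XsubC pC z) uC 0).
have c0 z : 0 <= c z by rewrite mulr_ge0 ?cnorm_ge0.
exists (\sum_(z <- rs) c z) => [|k]; first exact: sumr_ge0.
rewrite -cnorm_real (recurrence_spectral (s := fun i => (twist i)%:C) k urs) -rsE; last first.
  exact: recurrence_twist.
rewrite (le_trans (ler_cnorm_sum _ _ _))// big_seq [leRHS]big_seq ler_sum// => z.
rewrite -root_prod_XsubC -rsE => pz.
rewrite -/pC (twist_quot _ pz) expr0 mul1r /c 2!cnormM ler_wpM2l ?cnorm_ge0//.
have [->|za] := eqVneq z alpha%:C.
  by rewrite twist_at_alpha subrr !(mul0r, cnorm0, mulr0).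
rewrite ler_piMl ?cnorm_ge0// cnormX exprn_ile1 ?cnorm_ge0//.
by rewrite -lecR cnormE pz_le1.
Qed.

Lemma twist_eq0 : (forall z, root pC z -> gC.[z] = w%:C) -> forall k, twist k = 0.
Proof.
move=> gz k.
have [rs [urs _ rsE]] := irreducible_roots R[i] pm irp.
apply: (@complexI R); rewrite (recurrence_spectral (s := fun i => (twist i)%:C) k urs) -rsE; last first.
  exact: recurrence_twist.
rewrite big_seq big1// => z; rewrite -root_prod_XsubC -rsE => pz.
by rewrite -/pC twist_quot// gz// subrr mul0r !mulr0.
Qed.

(* The constant coefficient of p being a unit, the recurrence runs backwards over the integers. *)
Lemma integral_backwards k0 :
  (forall j, (j < (size p).-1)%N -> exists n : int, w * (u (k0 + j)%N)%:~R = n%:~R) ->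
  exists n : int, w * (u 0%N)%:~R = n%:~R.
Proof.
have szp : size p = (size p).-1.+1 by rewrite prednK// size_poly_gt0 monic_neq0.
elim: k0 => [|k0 IH] h.
  have d0 : (0 < (size p).-1)%N.
    by have := irp.1; rewrite size_rat_int_poly szp.
  exact: (h 0%N d0).
have [f fE] : exists f : nat -> int, forall j, (j < (size p).-1)%N ->
    w * (u (k0.+1 + j)%N)%:~R = (f j)%:~R.
  have /choice[f fP] : forall j, exists n : int, (j < (size p).-1)%N ->
      w * (u (k0.+1 + j)%N)%:~R = n%:~R; last by exists f.
  move=> j; have [/h[n nE]|] := boolP (j < (size p).-1)%N; first by exists n.
  by exists 0.
apply: IH => -[|j] jd; last first.
  by exists (f j); rewrite -fE ?addSnnS//; exact: ltnW.
exists (- p`_0 * \sum_(i < (size p).-1) p`_i.+1 * f i).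
have pk0 := pu k0.
rewrite /poly_act szp big_ord_recl /= addn0 in pk0.
rewrite addn0; have -> : u k0 = - p`_0 * \sum_(i < (size p).-1) p`_i.+1 * u (k0.+1 + i)%N.
  have <- : p`_0 ^+ 2 * u k0 = u k0 by rewrite (salem_coef0_sqr pm irp pa a1 pz_eq1) mul1r.
  rewrite expr2 -mulrA mulNr -mulrN; congr (_ * _); apply/eqP.
  rewrite -addr_eq0 -[X in _ == X]pk0; apply/eqP; congr (_ + _).
  by apply: eq_bigr => i _; rewrite addSnnS.
rewrite !rmorphM /= !rmorph_sum /= mulrCA; congr (_ * _).
rewrite mulr_sumr; apply: eq_bigr => i _.
by rewrite !rmorphM /= mulrCA fE.
Qed.

(** Suppose a whole window is within [delta] of integers [nn]. These integers obey the recurrence,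
    the bounded integer solution [D * nn - rho] vanishes, and [twist] is then exactly the error,
    below [delta]. Neither a surviving component of modulus 1 nor the non-integrality of [w * u 0]
    allows this. *)
Lemma salem_syndetic :
  u 0%N != 0 -> (forall n : int, w * (u 0%N)%:~R != n%:~R) ->
  exists (delta : R) (L : nat), 0 < delta /\ forall k0, exists2 k,
    (k0 <= k < k0 + L)%N & forall n : int, delta <= `|w * (u k)%:~R - n%:~R|.
Proof.
move=> u0 wu0.
(* [D] is a common denominator of the coefficients of [g], so [rho] is an integer sequence. *)
have [G [D D0 gE]] := rat_poly_scale g.
pose rho k : int := poly_act G u k.
have rhoE k : poly_act (map_poly ratr g) (fun i => (u i)%:~R) k = (rho k)%:~R / D%:~R :> R.
  rewrite gE map_polyZ fmorphV /= ratr_int map_poly_ratr_intr -mul_polyC poly_actM poly_actC.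
  by rewrite (poly_act_map (intr : {rmorphism int -> R})) mulrC.
have prho k : poly_act p rho k = 0.
  rewrite poly_actCA (eq_poly_act _ pu).
  by rewrite /poly_act big1// => i _; rewrite mulr0.
have [B0 B0_ge0 twistB] := twist_bounded.
(* This bounds [D * nn - rho], which is [D] times the difference of a twist, at most [B0], and an
   error, at most 1. *)
pose B := Num.bound (`|D%:~R| * (B0 + 1) : R).
have [L Lsz Lzero] := bounded_recurrence_eq0 B pm irp pa a1.
pose A : R := \sum_(i < size p) `|p`_i|%:~R.
have A0 : 0 <= A by apply: sumr_ge0 => i _; rewrite ler0z.
(* [kappa] is the size of the component of [twist] along [z0], the same at all times since [z0] has
   modulus 1. In the other alternative the values 0 and 1 are placeholders. *)
have [z0 [kappa [kappa0 kappaP]]] : exists z0 (kappa : R), 0 < kappa /\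
    ((root pC z0 /\ `|z0| = 1 /\ gC.[z0] != w%:C /\
       kappa = cnorm ((w%:C - gC.[z0]) * poly_act (quot_XsubC pC z0) uC 0)) \/
     (forall z, root pC z -> gC.[z] = w%:C)).
  have [[z [pz z1 gz]]|h] := pselect (exists z, [/\ root pC z, `|z| = 1 & gC.[z] != w%:C]).
    exists z, (cnorm ((w%:C - gC.[z]) * poly_act (quot_XsubC pC z) uC 0)); split; last by left.
    rewrite lt_neqAle cnorm_ge0 andbT eq_sym cnorm_eq0 mulf_eq0 negb_or.
    rewrite subr_eq0 eq_sym gz /=.
    exact: quot_XsubC_act_neq0 pm irp pz u0.
  exists 0, 1; split; first exact: ltr01.
  right; apply: (salem_rational_value irp pa a1 pz_le1 pz_eq1 gw) => z pz z1.
  by apply/eqP/negPn/negP => gz; apply: h; exists z.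
pose Q : R := \sum_(i < (size p).-1) cnorm (quot_XsubC pC z0)`_i.
have Q0 : 0 <= Q by apply: sumr_ge0 => i _; exact: cnorm_ge0.
(* The first term makes an integer combination of errors smaller than 1, hence zero; the second
   makes the component along [z0] smaller than [kappa]. *)
pose delta := Num.min (A + 1)^-1 (kappa / (Q + 1)).
have delta0 : 0 < delta.
  by rewrite lt_min invr_gt0 divr_gt0 ?ltr_pwDr.
have deltaA : delta * A < 1.
  have : delta * (A + 1) <= 1 by rewrite -ler_pdivlMr ?ltr_pwDr// div1r ge_min lexx.
  by lra.
have deltaQ : delta * Q < kappa.
  have : delta * (Q + 1) <= kappa by rewrite -ler_pdivlMr ?ltr_pwDr// ge_min lexx orbT.
  by lra.
exists delta, L; split => // k0.
have [//|near] := pselect (exists2 k, (k0 <= k < k0 + L)%N &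
  forall n : int, delta <= `|w * (u k)%:~R - n%:~R|).
exfalso.
have /choice[nn nnP] : forall j, exists n : int, (j < L)%N ->
    `|w * (u (k0 + j)%N)%:~R - n%:~R| < delta.
  move=> j; have [jL|_] := boolP (j < L)%N; last by exists 0.
  apply: contrapT => h; apply: near; exists (k0 + j)%N; first by rewrite leq_addr ltn_add2l.
  by move=> n; rewrite leNgt; apply/negP => nd; apply: h; exists n.
have szp : size p = (size p).-1.+1 by rewrite prednK// size_poly_gt0 monic_neq0.
have pnn k : (k + (size p).-1 < L)%N -> poly_act p nn k = 0.
  move=> kL; set x := poly_act p nn k.
  have xE : - x%:~R = \sum_(i < size p) (p`_i)%:~R *
      (w * (u (k0 + (k + i))%N)%:~R - (nn (k + i)%N)%:~R) :> R.
    under eq_bigr do rewrite mulrBr mulrCA.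
    rewrite sumrB -mulr_sumr /x /poly_act rmorph_sum /=.
    have -> : \sum_(i < size p) (p`_i)%:~R * (u (k0 + (k + i))%N)%:~R = 0 :> R.
      have /(congr1 (intr : int -> R)) := pu (k0 + k).
      rewrite /poly_act rmorph_sum rmorph0 => e0; rewrite -[RHS]e0.
      by apply: eq_bigr => i _; rewrite rmorphM /= addnA.
    by rewrite mulr0 sub0r; congr (- _); apply: eq_bigr => i _; rewrite rmorphM.
  have : `|x%:~R| < 1 :> R.
    rewrite -normrN xE; apply: le_lt_trans deltaA.
    rewrite (le_trans (ler_norm_sum _ _ _))// mulr_sumr ler_sum// => i _.
    rewrite normrM mulrC -intr_norm ler_wpM2r ?ler0z// ltW// nnP//.
    by rewrite (leq_ltn_trans _ kL)// leq_add2l -ltnS -szp.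
  rewrite -intr_norm ltrz1 ltr_norml => /andP[x1 x2]; clear -x1 x2; lia.
have delta1 : delta <= 1.
  have : delta <= (A + 1)^-1 by rewrite ge_min lexx.
  by move=> /le_trans; apply; rewrite invf_le1 ?ltr_pwDr// lerDr.
have nnrho k : (k < L)%N -> D * nn k - rho (k0 + k)%N = 0.
  apply: (Lzero (fun k => D * nn k - rho (k0 + k)%N)) => {}k kL.
    rewrite (@eq_poly_act _ _ _ (fun k => D * nn k + (-1) * rho (k0 + k)%N)); last first.
      by move=> j; rewrite mulN1r.
    rewrite poly_act_comb pnn// mulr0 add0r.
    apply/eqP; rewrite mulN1r oppr_eq0; apply/eqP; rewrite -(prho (k0 + k)%N).
    by rewrite /poly_act; apply: eq_bigr => i _; rewrite addnA.
  rewrite -(ler_int R) intr_norm (le_trans _ (ltW (archi_boundP _)))//; last first.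
    by rewrite mulr_ge0// addr_ge0.
  have -> : (D * nn k - rho (k0 + k)%N)%:~R =
      D%:~R * (twist (k0 + k)%N - (w * (u (k0 + k)%N)%:~R - (nn k)%:~R)) :> R.
    rewrite /twist rhoE rmorphB rmorphM /=; field.
    by rewrite intr_eq0.
  rewrite normrM ler_wpM2l// (le_trans (ler_normB _ _))// lerD//.
  by rewrite (le_trans _ delta1)// ltW// nnP.
have btwist j : (j < L)%N -> `|twist (k0 + j)%N| < delta /\
    twist (k0 + j)%N = w * (u (k0 + j)%N)%:~R - (nn j)%:~R.
  move=> jL; have -> : twist (k0 + j)%N = w * (u (k0 + j)%N)%:~R - (nn j)%:~R.
    rewrite /twist rhoE; congr (_ - _); have /eqP := nnrho _ jL.
    rewrite subr_eq0 => /eqP <-; rewrite rmorphM /= mulrAC divff ?mul1r//.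
    by rewrite intr_eq0.
  by split => //; exact: nnP.
case: kappaP => [[pz0 [z01 [_ kappaE]]]|gz].
  (* The component along [z0], computed from the first terms of the window, would be at most
     [delta * Q < kappa]. *)
  have := twist_quot k0 pz0 => /(congr1 (@cnorm R)).
  rewrite cnormM cnormX -kappaE.
  have -> : cnorm z0 = 1 by apply: complexI; rewrite cnormE z01.
  rewrite expr1n mul1r => /eqP; apply/negP; rewrite lt_eqF//.
  apply: le_lt_trans deltaQ.
  rewrite (@poly_actE _ _ _ _ (size p).-1); last first.
    by rewrite (leq_trans (size_poly _ _))// /pC size_map_poly_id0// (monicP pm) oner_eq0.
  rewrite (le_trans (ler_cnorm_sum _ _ _))// mulr_sumr ler_sum// => i _.
  rewrite cnormM mulrC ler_wpM2r ?cnorm_ge0// cnorm_real ltW// (btwist i _).1//.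
  by apply: leq_trans Lsz; rewrite (leq_trans (ltn_ord i))// leq_pred.
(* Here [twist] vanishes identically, so [w * u] is integral on the window, and integrality is
   propagated back to index 0. *)
have [n nE] : exists n : int, w * (u 0%N)%:~R = n%:~R.
  apply: (@integral_backwards k0) => j jd; exists (nn j).
  have jL : (j < L)%N by apply: leq_trans Lsz; rewrite (leq_trans jd)// leq_pred.
  have := (btwist j jL).2; rewrite twist_eq0// => /eqP.
  by rewrite eq_sym subr_eq0 => /eqP.
by have := wu0 n; rewrite nE eqxx.
Qed.

End SalemTwist.

(** * Words and twisted sums *)

Section Words.
Variables (n : nat) (zeta : substitution n).
Local Notation A := 'I_n.+2.

Definition iter_subst (k : nat) (w : seq A) : seq A := iter k (subst_word zeta) w.

Lemma iter_subst_cat k (v w : seq A) :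
  iter_subst k (v ++ w) = iter_subst k v ++ iter_subst k w.
Proof.
rewrite /iter_subst; elim: k => //= k ->.
by rewrite /subst_word map_cat flatten_cat.
Qed.

Lemma iter_subst_nil k : iter_subst k [::] = [::].
Proof. by rewrite /iter_subst; elim: k => //= k ->. Qed.

Lemma iter_substD j k (w : seq A) :
  iter_subst (j + k) w = iter_subst j (iter_subst k w).
Proof. by rewrite /iter_subst iterD. Qed.

Lemma iter_subst_cons k a (w : seq A) :
  iter_subst k (a :: w) = iter_subst k [:: a] ++ iter_subst k w.
Proof. by rewrite -cat1s iter_subst_cat. Qed.

Lemma iter_subst_flatten k (w : seq A) :
  iter_subst k w = flatten [seq iter_subst k [:: a] | a <- w].
Proof.
by elim: w => [|a w IH]; rewrite ?iter_subst_nil// iter_subst_cons IH.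
Qed.

Definition parikh (w : seq A) : 'cV[int]_n.+2 := \col_i (count_mem i w)%:Z.

Lemma parikh_cat (v w : seq A) : parikh (v ++ w) = parikh v + parikh w.
Proof. by apply/matrixP => i j; rewrite !mxE count_cat PoszD. Qed.

Lemma parikh_iter k (w : seq A) :
  parikh (iter_subst k w) = subst_mx zeta ^+ k *m parikh w.
Proof.
elim: k => [|k IH]; first by rewrite expr0 mul1mx.
rewrite exprS -mulmxE -mulmxA -IH -/(iter k _ _) /iter_subst iterS.
elim: (iter _ _ _) => [|a v IHv].
  by rewrite [parikh _](_ : _ = 0) ?mulmx0//; apply/matrixP => i j; rewrite !mxE.
rewrite /subst_word /= parikh_cat -cat1s parikh_cat mulmxDr -IHv; congr (_ + _).
apply/matrixP => i j; rewrite !mxE (bigD1 a)//= big1 => [|b ba].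
  by rewrite !mxE /= eqxx mulr1 addr0.
by rewrite !mxE /= eq_sym (negPf ba) mulr0.
Qed.

Lemma size_parikh (w : seq A) :
  (size w)%:Z = ((const_mx 1 : 'rV[int]_n.+2) *m parikh w) 0 0.
Proof.
elim: w => [|a w IH]; first by rewrite mxE big1// => i _; rewrite !mxE mulr0.
rewrite -cat1s size_cat parikh_cat mulmxDr mxE -IH PoszD; congr (_ + _).
rewrite mxE (bigD1 a)//= big1 => [|b ba].
  by rewrite !mxE /= eqxx mulr1.
by rewrite !mxE /= eq_sym (negPf ba) mulr0.
Qed.

(** The length is a fixed linear form in the vector [S ^+ k *m parikh w], and Cayley-Hamilton
    applies to [S]. *)
Lemma size_iter_recurrence (w : seq A) k :
  poly_act (char_poly (subst_mx zeta)) (fun i => (size (iter_subst i w))%:Z) k = 0.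
Proof.
have CH := Cayley_Hamilton (subst_mx zeta).
set S := subst_mx zeta in CH *.
have {}CH : \sum_(i < size (char_poly S)) (char_poly S)`_i *: S ^+ i = 0.
  rewrite -[RHS]CH -[in RHS](coefK (char_poly S)) poly_def rmorph_sum /=.
  by apply: eq_bigr => i _; rewrite linearZ /= rmorphXn /= horner_mx_X.
transitivity (((const_mx 1 : 'rV[int]_n.+2) *m
   (\sum_(i < size (char_poly S)) (char_poly S)`_i *: S ^+ i) *m
   (S ^+ k *m parikh w)) 0 0); last first.
  by rewrite CH mulmx0 mul0mx mxE.
rewrite mulmx_sumr mulmx_suml summxE; apply: eq_bigr => i _.
rewrite size_parikh parikh_iter -scalemxAr -scalemxAl [in RHS]mxE; congr (_ * _).
by rewrite -!mulmxA (mulmxA (S ^+ i)) mulmxE -exprD [(i + k)%N]addnC.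
Qed.

Lemma primitive_mem : primitive_subst zeta ->
  exists p, forall a b : A, a \in iter_subst p [:: b].
Proof.
move=> [p pP]; exists p => a b; rewrite -has_pred1 has_count.
have /matrixP/(_ a 0) := parikh_iter p [:: b].
rewrite !mxE (bigD1 b)//= big1 => [|c cb]; last first.
  by rewrite !mxE /= eq_sym (negPf cb) mulr0.
by rewrite !mxE /= eqxx mulr1 addr0 -ltz_nat => ->; exact: pP.
Qed.

Lemma size_iter_gt0 k (a : A) : (0 < size (iter_subst k [:: a]))%N.
Proof.
suff h (w : seq A) : w != [::] -> iter_subst k w != [::].
  by have := h [:: a] isT; case: (iter_subst _ _).
move=> w0; rewrite /iter_subst; elim: k => //= k.
case: (iter _ _ _) => // b v _; rewrite /subst_word /=.
by have := subst_nonempty zeta b; case: (zeta b).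
Qed.

Lemma size_iter_le : exists2 K : nat, (1 < K)%N &
  forall k (a : A), (size (iter_subst k [:: a]) <= K ^ k)%N.
Proof.
(* The [.+2] guarantees [1 < K], needed later for a base of exponential growth. *)
pose K := (\max_a size (zeta a)).+2; exists K => // k.
suff h (w : seq A) : (size (iter_subst k w) <= size w * K ^ k)%N.
  by move=> a; rewrite (leq_trans (h _))// mul1n.
elim: k => [|k IH]; first by rewrite muln1.
rewrite /iter_subst iterS -/(iter_subst k w) expnSr mulnA.
apply: leq_trans (leq_mul IH (leqnn _)); elim: (iter_subst k w) => //= b v IHv.
rewrite /subst_word /= size_cat mulSn leq_add//.
exact: leqW (leqW (@leq_bigmax _ (fun a => size (zeta a)) b)).
Qed.

Lemma size_iter_mem k a (w : seq A) : a \in w ->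
  (size (iter_subst k [:: a]) <= size (iter_subst k w))%N.
Proof.
move=> aw; have /splitPr[v1 v2] := aw.
rewrite iter_subst_cat (iter_subst_cons k a v2) !size_cat.
by rewrite addnCA leq_addr.
Qed.

(** After writing the level [k] as [k + p], the word from [a] contains a block of level [k] for
    every letter, hence is at least as long as each of them; the word from [c] consists of a bounded
    number of such blocks. *)
Lemma size_iter_comparable p q :
  (forall a b : A, a \in iter_subst p [:: b]) ->
  exists2 M : nat, (0 < M)%N & forall k (a c : A), (p <= k)%N ->
    (size (iter_subst (k + q) [:: c]) <= M * size (iter_subst k [:: a]))%N.
Proof.
move=> pP; exists (\max_(c : A) size (iter_subst (p + q) [:: c])).
  apply: leq_trans (size_iter_gt0 (p + q) ord0) _.
  exact: (@leq_bigmax _ (fun c => size (iter_subst (p + q) [:: c]))).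
move=> k a c /subnK <-; move: (k - p)%N => {}k.
rewrite -addnA (iter_substD k (p + q)) (iter_substD k p).
apply: (@leq_trans (size (iter_subst (p + q) [:: c]) *
    size (iter_subst k (iter_subst p [:: a])))); last first.
  apply: leq_mul => //.
  exact: (@leq_bigmax _ (fun c => size (iter_subst (p + q) [:: c]))).
elim: (iter_subst (p + q) _) => [|b v IH].
  by rewrite iter_subst_nil.
by rewrite iter_subst_cons size_cat mulSn leq_add// size_iter_mem.
Qed.

End Words.

(** Horner form of the sum of [x ^+ k] over the positions [k] of the letter [b] in [w], the twisted
    Birkhoff sum of its indicator. *)
Definition twisted_sum (R : rcfType) (T : eqType) (x : R[i]) (b : T) (w : seq T) : R[i] :=
  foldr (fun a s => (a == b)%:R + x * s) 0 w.

Lemma twisted_sum_cat (R : rcfType) (T : eqType) (x : R[i]) (b : T) (v w : seq T) :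
  twisted_sum x b (v ++ w) = twisted_sum x b v + x ^+ size v * twisted_sum x b w.
Proof.
elim: v => [|a v IH] /=; first by rewrite add0r expr0 mul1r.
by rewrite -/(twisted_sum _ _ _) IH mulrDr addrA exprS -mulrA.
Qed.

Lemma cnorm_twisted_sum_cat (R : rcfType) (T : eqType) (x : R[i]) (b : T) (v w : seq T) :
  cnorm x = 1 ->
  cnorm (twisted_sum x b (v ++ w)) <= cnorm (twisted_sum x b v) + cnorm (twisted_sum x b w).
Proof.
move=> x1; rewrite twisted_sum_cat (le_trans (ler_cnormD _ _))//.
by rewrite cnormM cnormX x1 expr1n mul1r.
Qed.

Lemma cnorm_twisted_sum (R : rcfType) (T : eqType) (x : R[i]) (b : T) (w : seq T) :
  cnorm x = 1 -> cnorm (twisted_sum x b w) <= (size w)%:R.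
Proof.
move=> x1; elim: w => [|a w IH]; first by rewrite [cnorm _]cnorm0.
rewrite /= -/(twisted_sum _ _ _) (le_trans (ler_cnormD _ _))// -addn1 natrD addrC.
rewrite lerD ?cnormM ?x1 ?mul1r//.
by case: (a == b); [rewrite [cnorm _]Normc.normc1|rewrite [cnorm _]cnorm0].
Qed.

Lemma twisted_sum_mkseq (R : rcfType) (T : eqType) (x : R[i]) (b : T) (f : nat -> T) N :
  twisted_sum x b [seq f k | k <- iota 0 N] = \sum_(k < N) x ^+ k * (f k == b)%:R.
Proof.
elim: N => [|N IH]; first by rewrite big_ord0.
rewrite -addn1 iotaD map_cat twisted_sum_cat IH addn1 big_ord_recr /=.
by rewrite size_map size_iota mulr0 addr0.
Qed.

(** * Geometric decay of twisted sums along the levels of the substitution *)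

Section Decay.
Variables (R : realType) (n : nat) (zeta : substitution n) (x : R[i]).
Hypothesis x1 : cnorm x = 1.

Definition level_bound (b : 'I_n.+2) (k : nat) (t : R) : Prop :=
  forall a : 'I_n.+2, cnorm (twisted_sum x b (iter_subst zeta k [:: a])) <=
    t * (size (iter_subst zeta k [:: a]))%:R.

Lemma level_bound_word b k t : level_bound b k t -> forall w : seq 'I_n.+2,
  cnorm (twisted_sum x b (iter_subst zeta k w)) <= t * (size (iter_subst zeta k w))%:R.
Proof.
move=> h; elim=> [|a w IH].
  by rewrite iter_subst_nil [cnorm _]cnorm0 mulr0.
rewrite iter_subst_cons (le_trans (cnorm_twisted_sum_cat _ _ _ x1))//.
by rewrite size_cat natrD mulrDr lerD.
Qed.

Lemma level_boundD b j k t : level_bound b k t -> level_bound b (k + j) t.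
Proof. by move=> h a; rewrite iter_substD; exact: level_bound_word. Qed.

Lemma level_bound1 b k : level_bound b k 1.
Proof. by move=> a; rewrite mul1r cnorm_twisted_sum. Qed.

(* Two occurrences of the same letter partially cancel. *)
Lemma level_bound_gain b k q a (v y1 y2 : seq 'I_n.+2) (c : 'I_n.+2) (t eta : R) :
  level_bound b k t ->
  iter_subst zeta q [:: c] = y1 ++ (a :: v) ++ a :: y2 ->
  cnorm (1 + x ^+ size (iter_subst zeta k (a :: v))) <= 2 - eta ->
  cnorm (twisted_sum x b (iter_subst zeta (k + q) [:: c])) <=
    t * ((size (iter_subst zeta (k + q) [:: c]))%:R -
         eta * (size (iter_subst zeta k [:: a]))%:R).
Proof.
move=> h qE gain; rewrite iter_substD qE !iter_subst_cat.
have hw := level_bound_word h.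
rewrite (iter_subst_cons _ k a v) in gain *; rewrite (iter_subst_cons _ k a y2).
set Y1 := iter_subst zeta k y1; set Y2 := iter_subst zeta k y2.
set V := iter_subst zeta k v in gain *; set W := iter_subst zeta k [:: a] in gain *.
rewrite (le_trans (cnorm_twisted_sum_cat _ _ _ x1))//.
have -> : twisted_sum x b ((W ++ V) ++ W ++ Y2) =
    (1 + x ^+ size (W ++ V)) * twisted_sum x b W + x ^+ size W * twisted_sum x b V +
    x ^+ size (W ++ V) * (x ^+ size W * twisted_sum x b Y2).
  by rewrite !twisted_sum_cat size_cat exprD; ring.
have b1 : cnorm ((1 + x ^+ size (W ++ V)) * twisted_sum x b W) <= (2 - eta) * (t * (size W)%:R).
  by rewrite cnormM ler_pM ?cnorm_ge0//; exact: h.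
have b2 : cnorm (x ^+ size W * twisted_sum x b V) <= t * (size V)%:R.
  by rewrite cnormM cnormX x1 expr1n mul1r; exact: hw.
have b3 : cnorm (x ^+ size (W ++ V) * (x ^+ size W * twisted_sum x b Y2)) <= t * (size Y2)%:R.
  by rewrite !cnormM !cnormX x1 !expr1n !mul1r; exact: hw.
have b0 : cnorm (twisted_sum x b Y1) <= t * (size Y1)%:R by exact: hw.
have tri := ler_cnormD ((1 + x ^+ size (W ++ V)) * twisted_sum x b W + x ^+ size W * twisted_sum x b V)
  (x ^+ size (W ++ V) * (x ^+ size W * twisted_sum x b Y2)).
have tri2 := ler_cnormD ((1 + x ^+ size (W ++ V)) * twisted_sum x b W) (x ^+ size W * twisted_sum x b V).
have -> : (size ((iter_subst zeta k y1) ++ (W ++ V) ++ W ++ Y2))%:R =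
    (size Y1)%:R + ((size W)%:R + (size V)%:R + ((size W)%:R + (size Y2)%:R)) :> R.
  by rewrite !size_cat !natrD.
move: b0 b1 b2 b3 tri tri2; lra.
Qed.

Variables (a : 'I_n.+2) (v : seq 'I_n.+2) (q Lw p : nat) (eta : R).
Hypotheses (eta_gt0 : 0 < eta) (eta_le1 : eta <= 1).
Hypothesis return_q : forall c, exists y1 y2 : seq 'I_n.+2,
  iter_subst zeta q [:: c] = y1 ++ (a :: v) ++ a :: y2.
Hypothesis syndetic : forall k0, exists2 k, (k0 <= k < k0 + Lw)%N &
  cnorm (1 + x ^+ size (iter_subst zeta k (a :: v))) <= 2 - eta.
Hypothesis primitive_p : forall a b : 'I_n.+2, a \in iter_subst zeta p [:: b].

(** Every [Lw] consecutive levels contain one where the return word yields a cancellation. It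
    affects a block filling at least a fraction [1 / M] of the word [q] levels higher, which shrinks
    the ratio by the factor [rho]. *)
Lemma level_bound_decay : exists2 rho : R, 0 < rho < 1 &
  forall b j, level_bound b (p + j * (Lw + q))%N (rho ^+ j).
Proof.
have [M M0 MP] := size_iter_comparable q primitive_p.
have M1 : 1 <= M%:R :> R by rewrite ler1n.
have M0R : 0 < M%:R :> R by rewrite ltr0n.
(* The factor 2 keeps rho positive when eta = M = 1. *)
pose rho : R := 1 - eta / (2 * M%:R).
have M2 : 0 < 2 * M%:R :> R by rewrite mulr_gt0.
have etaM : 0 < eta / (2 * M%:R) <= 1 / 2.
  apply/andP; split; first exact: divr_gt0.
  rewrite ler_pdivrMr// (_ : 1 / 2 * (2 * M%:R) = M%:R); last by field.
  exact: le_trans M1.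
have rho01 : 0 < rho < 1 by rewrite /rho; move: etaM => /andP[]; lra.
exists rho => // b; elim=> [|j IH]; first exact: level_bound1.
have [k /andP[k1 k2] gain] := syndetic (p + j * (Lw + q))%N.
have t0 : 0 <= rho ^+ j by rewrite exprn_ge0// ltW//; case/andP: rho01.
have hk : level_bound b k (rho ^+ j) by rewrite -(subnKC k1); exact: level_boundD.
have : level_bound b (k + q)%N (rho ^+ j.+1).
  move=> c; have [y1 [y2 qE]] := return_q c.
  apply: (le_trans (level_bound_gain hk qE gain)).
  rewrite exprSr -mulrA ler_wpM2l// /rho mulrBl mul1r lerD2l lerN2.
  have := MP k a c (leq_trans (leq_addr _ _) k1); rewrite -(ler_nat R) natrM => sz.
  rewrite mulrAC ler_pdivrMr// -mulrA ler_wpM2l ?(ltW eta_gt0)//.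
  apply: (le_trans sz); rewrite mulrC ler_wpM2l//.
  by move: M0R; lra.
(* The truncated subtraction is exact by [k2]; the bound reached at level [k + q] persists up to the
   prescribed level. *)
have -> : (p + j.+1 * (Lw + q) = (k + q) + (p + j * (Lw + q) + Lw - k))%N.
  by rewrite mulSn; lia.
exact: level_boundD.
Qed.

End Decay.

(** * From images of letters to arbitrary words of the language *)

Lemma prefix_flatten_map (S T : eqType) (F : S -> seq T) (A : nat) (y : seq S) N :
  (forall a, (size (F a) <= A)%N) ->
  exists y' t, take N (flatten (map F y)) = flatten (map F y') ++ t /\ (size t <= A)%N.
Proof.
move=> hA; elim: y N => [|a y IH] N; first by exists [::], [::].
rewrite /= take_cat; case: ltnP => h.
  exists [::], (take N (F a)); split => //.
  by rewrite (leq_trans _ (hA a))// size_take_min geq_minr.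
have [y' [t [-> ht]]] := IH (N - size (F a))%N.
by exists (a :: y'), t; rewrite /= catA.
Qed.

(** Only the first and the last block met by the factor can be truncated. This brings any word of
    the language down to full blocks, controlled by [level_bound], and two short ends. *)
Lemma infix_flatten_map (S T : eqType) (F : S -> seq T) (A : nat) (y : seq S) (w : seq T) :
  (forall a, (size (F a) <= A)%N) -> infix w (flatten (map F y)) ->
  exists s y' t, [/\ w = s ++ flatten (map F y') ++ t, (size s <= A)%N & (size t <= A)%N].
Proof.
move=> hA /infixP[u [u' E]].
have -> : w = take (size w) (drop (size u) (flatten (map F y))).
  by rewrite E drop_size_cat// take_size_cat.
move: (size w) (size u) => N i; elim: y i {E} => [|a y IH] i.
  by exists [::], [::], [::]; split.
rewrite /= drop_cat; case: ltnP => h; last exact: IH.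
rewrite take_cat; case: ltnP => h'.
  exists (take N (drop i (F a))), [::], [::]; rewrite /= cats0; split => //.
  rewrite (leq_trans _ (hA a))// size_take_min size_drop.
  by rewrite (leq_trans (geq_minr _ _))// leq_subr.
have [y' [t [-> ht]]] := prefix_flatten_map y (N - size (drop i (F a)))%N hA.
exists (drop i (F a)), y', t; split => //.
by rewrite (leq_trans _ (hA a))// size_drop leq_subr.
Qed.

Lemma cnorm_twisted_sum_infix (R : realType) (n : nat) (zeta : substitution n)
    (x : R[i]) (b : 'I_n.+2) (K k m : nat) (t : R) (a : 'I_n.+2) (w : seq 'I_n.+2) :
  cnorm x = 1 -> (0 < K)%N ->
  (forall k a, (size (iter_subst zeta k [:: a]) <= K ^ k)%N) ->
  0 <= t -> level_bound zeta x b k t ->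
  infix w (iter_subst zeta m [:: a]) ->
  cnorm (twisted_sum x b w) <= 2 * (K ^ k)%:R + t * (size w)%:R.
Proof.
(* Below level [k] the word is shorter than [K ^ k] and the trivial bound is enough; otherwise it is
   cut into blocks of level [k]. *)
move=> x1 K0 szK t0 hk wm; have [mk|km] := ltnP m k.
  rewrite (le_trans (cnorm_twisted_sum _ _ x1))// -[leLHS]addr0 lerD ?mulr_ge0//.
  have : (size w <= K ^ k)%N.
    apply: (leq_trans (size_infix wm)); apply: (leq_trans (szK _ _)).
    by rewrite leq_pexp2l// ltnW.
  rewrite -(ler_nat R) => h; apply: (le_trans h).
  by have : 0 <= (K ^ k)%:R :> R; [|lra].
move: wm; rewrite -(subnKC km) iter_substD iter_subst_flatten => wm.
have [s [y [u [-> hs hu]]]] := infix_flatten_map (szK k) wm.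
rewrite -iter_subst_flatten; apply: (le_trans (cnorm_twisted_sum_cat _ _ _ x1)).
have h1 := cnorm_twisted_sum_cat b (iter_subst zeta k y) u x1.
have h2 := level_bound_word x1 hk y.
have h3 := le_trans (cnorm_twisted_sum b s x1) (eqbRL (ler_nat R _ _) hs).
have h4 := le_trans (cnorm_twisted_sum b u x1) (eqbRL (ler_nat R _ _) hu).
have h5 : t * (size (iter_subst zeta k y))%:R <= t * (size (s ++ iter_subst zeta k y ++ u))%:R.
  by rewrite ler_wpM2l// ler_nat !size_cat addnCA leq_addr.
by move: h1 h2 h3 h4 h5; lra.
Qed.

(** * Return words *)

(** The row is killed by [S ^+ j - S ^+ i], an invertible rational matrix: ['X^j - 'X^i] does not
    vanish at [alpha > 1], so it is invertible modulo the characteristic polynomial, and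
    Cayley-Hamilton applies. *)
Lemma row_orbit_eq0 (F : numFieldType) n (S : 'M[int]_n.+1) (alpha : F)
    (h : 'rV[int]_n.+1) (i j : nat) :
  irreducible_poly (pQ (char_poly S)) ->
  root (map_poly intr (char_poly S)) alpha -> 1 < alpha -> (i < j)%N ->
  h *m S ^+ i = h *m S ^+ j -> h = 0.
Proof.
move=> irS Sa a1 ij hij.
pose q : {poly rat} := 'X^j - 'X^i.
have nqa : ~~ root (map_poly ratr q) alpha.
  rewrite rmorphB /= !map_polyXn rootE !hornerE subr_eq0.
  by rewrite (inj_eq (ieexprIn (lt_trans ltr01 a1) _)) ?gt_eqF.
have [v /dvdpP[c vq]] := inverse_mod_irreducible irS Sa nqa.
pose SQ : 'M[rat]_n.+1 := map_mx intr S.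
pose hQ : 'rV[rat]_n.+1 := map_mx intr h.
have hq : hQ *m horner_mx SQ q = 0.
  have SX k : SQ ^+ k = map_mx intr (S ^+ k) by rewrite rmorphXn.
  rewrite rmorphB /= !rmorphXn /= !horner_mx_X mulmxBr !SX -!map_mxM hij.
  by rewrite subrr.
have h1 : hQ = 0.
  rewrite -[hQ]mulmx1.
  have -> : 1%:M = horner_mx SQ (q * v - pQ (char_poly S) * c).
    rewrite (mulrC q) (mulrC _ c) -vq opprB addrC subrK.
    by rewrite -polyC1 horner_mx_C.
  have -> : pQ (char_poly S) = char_poly SQ by rewrite map_char_poly.
  rewrite rmorphB !rmorphM /= Cayley_Hamilton mul0r subr0.
  by rewrite -mulmxE mulmxA hq mul0mx.
apply/matrixP => k l; have /matrixP/(_ k l) := h1; rewrite !mxE => /eqP.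
by rewrite intr_eq0 => /eqP.
Qed.

Definition is_integer (R : pzRingType) (t : R) : Prop := exists m : int, t = m%:~R.

Lemma is_integerB (R : pzRingType) (s t : R) :
  is_integer s -> is_integer t -> is_integer (s - t).
Proof. by move=> [k ->] [m ->]; exists (k - m); rewrite rmorphB. Qed.

Lemma is_integerN (R : pzRingType) (t : R) : is_integer t -> is_integer (- t).
Proof. by move=> [k ->]; exists (- k); rewrite rmorphN. Qed.

Section ReturnWord.
Variables (R : realType) (n : nat) (zeta : substitution n) (alpha w : R).
Hypotheses (irS : irreducible_poly (pQ (char_poly (subst_mx zeta))))
  (Sa : root (map_poly intr (char_poly (subst_mx zeta))) alpha) (a1 : 1 < alpha)
  (zetaP : primitive_subst zeta) (wN : ~ is_integer w).

Let no_return := forall m b a (v y1 y2 : seq 'I_n.+2),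
  iter_subst zeta m [:: b] = y1 ++ (a :: v) ++ a :: y2 ->
  is_integer (w * (size (a :: v))%:R).

Lemma no_return_nth m b i j : no_return ->
  (i < size (iter_subst zeta m [:: b]))%N ->
  (j < size (iter_subst zeta m [:: b]))%N ->
  nth b (iter_subst zeta m [:: b]) i = nth b (iter_subst zeta m [:: b]) j ->
  is_integer (w * (j%:R - i%:R)).
Proof.
move=> nr; set W := iter_subst _ _ _.
suff h i' j' : (i' < j')%N -> (j' < size W)%N -> nth b W i' = nth b W j' ->
    is_integer (w * (j'%:R - i'%:R)).
  move=> iW jW e; case: (ltngtP i j) => ij.
  - exact: h.
  - by rewrite -opprB mulrN; apply: is_integerN; apply: h.
  - by exists 0; rewrite ij subrr mulr0.
move=> ij jW e.
have iW : (i' < size W)%N by exact: ltn_trans jW.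
have E : W = take i' W ++ (nth b W i' :: drop i'.+1 (take j' W)) ++ nth b W i' :: drop j'.+1 W.
  rewrite [in X in _ ++ _ ++ X]e -drop_nth//.
  have -> : nth b W i' = nth b (take j' W) i' by rewrite nth_take.
  rewrite -drop_nth ?size_takel//; last exact: ltnW.
  have -> : take i' W = take i' (take j' W) by rewrite take_takel// ltnW.
  by rewrite catA !cat_take_drop.
have := nr _ _ _ _ _ _ E.
rewrite /= size_drop size_takel; last exact: ltnW.
by rewrite -subSn// subSS natrB// ltnW.
Qed.

Lemma return_word_nonintegral :
  exists m b a (v y1 y2 : seq 'I_n.+2),
    iter_subst zeta m [:: b] = y1 ++ (a :: v) ++ a :: y2 /\
    ~ is_integer (w * (size (a :: v))%:R).
Proof.
apply: contrapT => nex.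
have nr : no_return.
  move=> m b a v y1 y2 E; apply: contrapT => h; apply: nex.
  by exists m, b, a, v, y1, y2.
have [p pP] := primitive_mem zetaP.
pose b0 : 'I_n.+2 := ord0.
pose W0 := iter_subst zeta p [:: b0].
(* Every letter occurs in [W0], so its first occurrence there serves as a reference position. *)
pose pos (x : 'I_n.+2) : R := (index x W0)%:R.
(* Positions in [W] and in [W0] are compared inside [Om], which contains both words; [p <= m] makes
   [b0] occur in its own image of level [m]. *)
have same m b i j : (p <= m)%N -> (i < size (iter_subst zeta m [:: b]))%N ->
    (j < size (iter_subst zeta m [:: b]))%N ->
    is_integer (w * ((j%:R - i%:R) - (pos (nth b (iter_subst zeta m [:: b]) j) -
                                      pos (nth b (iter_subst zeta m [:: b]) i)))).
  move=> pm iW jW; set W := iter_subst _ _ _ in iW jW *.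
  pose Om := iter_subst zeta (m + p) [:: b0].
  have [u1 [u2 Om1]] : exists u1 u2, Om = u1 ++ W ++ u2.
    rewrite /Om iter_substD; have /splitPr[v1 v2] := pP b b0.
    exists (iter_subst zeta m v1), (iter_subst zeta m v2).
    by rewrite iter_subst_cat (iter_subst_cons _ m b v2).
  have [u3 [u4 Om2]] : exists u1 u2, Om = u1 ++ W0 ++ u2.
    have b0m : b0 \in iter_subst zeta m [:: b0].
      rewrite -(subnKC pm) iter_substD.
      have := size_iter_gt0 zeta (m - p) b0; case: (iter_subst _ (m - p) _) => // c s _.
      by rewrite iter_subst_cons mem_cat pP.
    rewrite /Om addnC iter_substD; have /splitPr[v1 v2] := b0m.
    exists (iter_subst zeta p v1), (iter_subst zeta p v2).
    by rewrite iter_subst_cat (iter_subst_cons _ p b0 v2).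
  have key k : (k < size W)%N ->
      is_integer (w * ((size u1 + k)%:R - (size u3 + index (nth b W k) W0)%:R)).
    move=> kW; set x := nth b W k.
    have xW0 : (index x W0 < size W0)%N by rewrite index_mem pP.
    apply: (@no_return_nth (m + p) b0) => //; rewrite -/Om.
    - by rewrite Om2 !size_cat ltn_add2l ltn_addr.
    - by rewrite Om1 !size_cat ltn_add2l ltn_addr.
    have nth_mid (r s t : seq 'I_n.+2) l : (l < size s)%N ->
        nth b0 (r ++ s ++ t) (size r + l) = nth b0 s l.
      by move=> ls; rewrite nth_cat ltnNge leq_addr /= addKn nth_cat ls.
    rewrite {1}Om2 Om1 !nth_mid//.
    by rewrite nth_index ?pP//; exact: set_nth_default.
  have := is_integerB (key j jW) (key i iW).
  rewrite -mulrBr !natrD; congr (is_integer (w * _)); rewrite /pos; ring.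
(* An integer-valued function of [w * t] modulo 1, which turns the positions modulo 1 into an
   integer vector. *)
pose X (t : R) : int := `[< is_integer (w * t) >]%:R.
have XE s t : is_integer (w * (s - t)) -> X s = X t.
  move=> st; rewrite /X; congr (nat_of_bool _)%:R; apply: asbool_equiv_eq; split.
    move=> h; have := is_integerB h st; congr is_integer; ring.
  by move=> h; have := is_integerB h (is_integerN st); congr is_integer; ring.
(* Along a word the weights of the letters given by h telescope. *)
pose h : 'rV[int]_n.+2 := \row_x (X (pos x - pos b0) - X (pos x - pos b0 - 1)).
have hb m b : (p <= m)%N -> `|(h *m subst_mx zeta ^+ m) 0 b| <= 1.
  move=> pm; have -> : (h *m subst_mx zeta ^+ m) 0 b =
      \sum_(x <- iter_subst zeta m [:: b]) h 0 x.
    have -> : (h *m subst_mx zeta ^+ m) 0 b = (h *m parikh (iter_subst zeta m [:: b])) 0 0.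
      rewrite parikh_iter mulmxA [RHS]mxE (bigD1 b)//= big1 => [|c cb].
        by rewrite !mxE /= eqxx mulr1 addr0.
      by rewrite !mxE /= eq_sym (negPf cb) mulr0.
    elim: (iter_subst _ _ _) => [|a s IH].
      by rewrite big_nil mxE big1// => i _; rewrite !mxE mulr0.
    rewrite big_cons -IH -cat1s parikh_cat mulmxDr mxE; congr (_ + _).
    rewrite mxE (bigD1 a)//= big1 => [|c ca].
      by rewrite [parikh _ _ _]mxE /= eqxx mulr1 addr0.
    by rewrite [parikh _ _ _]mxE /= eq_sym (negPf ca) mulr0.
  set W := iter_subst _ _ _.
  pose c : R := pos (nth b W 0) - pos b0.
  have W0s : (0 < size W)%N by exact: size_iter_gt0.
  have e1 (I P Q S : R) : - (I - (P - Q)) = P - S - (I + 1 - 1 + (Q - S)) by ring.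
  have e2 (I P Q S : R) : - (I - (P - Q)) = P - S - 1 - (I - 1 + (Q - S)) by ring.
  rewrite (big_nth b) big_mkord.
  under eq_bigr => i _.
    rewrite mxE.
    have iW := same m b 0 i pm W0s (ltn_ord i); rewrite -/W in iW.
    rewrite (XE _ (i.+1%:R - 1 + c)); last first.
      have := is_integerN iW; rewrite -mulrN; congr (is_integer (w * _)).
      rewrite /c -natr1 subr0; exact: e1.
    rewrite (XE (pos (nth b W i) - pos b0 - 1) (i%:R - 1 + c)); last first.
      have := is_integerN iW; rewrite -mulrN; congr (is_integer (w * _)).
      rewrite /c subr0; exact: e2.
  over.
  rewrite -(big_mkord xpredT (fun i => X (i.+1%:R - 1 + c) - X (i%:R - 1 + c))).
  rewrite telescope_sumr// /X; do 2 case: (`[< _ >]) => //=.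
pose T := {ffun 'I_n.+2 -> 'I_3}.
(* The entries lie in {-1, 0, 1}, being differences of two indicators; adding 1 encodes them in
   ['I_3]. *)
pose st (k : nat) : T := [ffun b => inord (absz ((h *m subst_mx zeta ^+ (p + k)) 0 b + 1))].
have [i [j [ij _ stij]]] := pigeonhole_nat st.
have hij : h *m subst_mx zeta ^+ (p + i) = h *m subst_mx zeta ^+ (p + j).
  apply/rowP => b; move/ffunP: stij => /(_ b); rewrite !ffunE /=.
  move: (hb (p + i)%N b (leq_addr _ _)) (hb (p + j)%N b (leq_addr _ _)).
  move: ((h *m _ ^+ (p + i)) 0 b) ((h *m _ ^+ (p + j)) 0 b) => s t.
  rewrite !ler_norml => /andP[h1 h2] /andP[h3 h4] /(congr1 val) /=.
  by clear -h1 h2 h3 h4; rewrite !inordK; lia.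
have h0 : h = 0 by apply: row_orbit_eq0 irS Sa a1 _ hij; rewrite ltn_add2l.
(* The entry of [h] at [b0] is [X 0 - X (-1) = 1 - 0], because [w] is not an integer. *)
have /rowP/(_ b0) := h0; rewrite !mxE subrr /X mulr0 sub0r mulrN1.
rewrite asboolT; last by exists 0.
rewrite asboolF//; move=> /is_integerN; rewrite opprK; exact: wN.
Qed.

End ReturnWord.

(** * Measures on the substitution space *)

Lemma sumEFin_fun (R : realType) (T I : Type) (s : seq I) (F : I -> T -> R) :
  EFin \o (fun x => \sum_(i <- s) F i x) = (fun x => (\sum_(i <- s) (F i x)%:E)%E).
Proof. by apply/funext => x /=; rewrite sumEFin. Qed.

Lemma integrable_Rsum (R : realType) d (T : measurableType d)
    (mu : {measure set T -> \bar R}) (D : set T) (I : Type) (s : seq I) (F : I -> T -> R) :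
  measurable D -> (forall i, mu.-integrable D (EFin \o F i)) ->
  mu.-integrable D (EFin \o (fun x => \sum_(i <- s) F i x)).
Proof.
move=> mD iF; rewrite sumEFin_fun.
by apply: (@integrable_sum _ _ _ _ _ mD I s xpredT (fun i => EFin \o F i)) => i _.
Qed.

Lemma Rintegral_sum (R : realType) d (T : measurableType d)
    (mu : {measure set T -> \bar R}) (D : set T) (I : Type) (s : seq I) (F : I -> T -> R) :
  measurable D -> (forall i, mu.-integrable D (EFin \o F i)) ->
  \int[mu]_(x in D) (\sum_(i <- s) F i x) = \sum_(i <- s) \int[mu]_(x in D) F i x.
Proof.
move=> mD iF; elim: s => [|i s IH].
  by under eq_Rintegral do rewrite big_nil; rewrite Rintegral_cst// mul0r big_nil.
under eq_Rintegral do rewrite big_cons.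
by rewrite RintegralD// ?IH ?big_cons//; exact: integrable_Rsum.
Qed.

Lemma integrableRZl (R : realType) d (T : measurableType d)
    (mu : {measure set T -> \bar R}) (D : set T) (c : R) (F : T -> R) :
  measurable D -> mu.-integrable D (EFin \o F) ->
  mu.-integrable D (EFin \o (fun x => c * F x)).
Proof.
move=> mD iF.
have -> : EFin \o (fun x => c * F x) = (fun x => c%:E * (EFin \o F) x)%E.
  by apply/funext => x /=; rewrite EFinM.
exact: integrableZl.
Qed.

(** * Cylinder sets and integrals of functions of two coordinates *)

Section Cylinders.
Variables (n : nat).
Local Notation T := (borel_seq_space n).

Lemma measurable_coord (i : int) (a : 'I_n.+2) :
  measurable ([set x : T | x i = a] : set T).
Proof.
apply: sub_gen_smallest => /=.
have -> : [set x : seq_space n | x i = a] =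
    @proj int (fun _ => discrete_topology 'I_n.+2) i @^-1` [set a] by [].
apply: open_comp; last exact: discrete_open.
by move=> x _; exact: proj_continuous.
Qed.

Lemma measurable_word_at (i : int) (l : nat) (u : seq 'I_n.+2) :
  measurable ([set x : T | word_at x i l = u] : set T).
Proof.
have [ul|ul] := eqVneq (size u) l; last first.
  have -> : [set x : T | word_at x i l = u] = set0.
    apply/seteqP; split => // x /= xu; move: ul; rewrite -xu.
    by rewrite size_map size_iota eqxx.
  exact: measurable0.
have -> : [set x : T | word_at x i l = u] =
    \bigcap_k (if (k < l)%N then [set x : T | x (i + k%:Z) = nth ord0 u k] else setT).
  apply/seteqP; split => x /=.
    move=> xu k _; case: ifP => // kl /=.
    by rewrite -xu (nth_map 0%N) ?size_iota// nth_iota.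
  move=> h; apply: (@eq_from_nth _ ord0); rewrite size_map size_iota// => k kl.
  have := h k I; rewrite kl /= => <-.
  by rewrite (nth_map 0%N) ?size_iota// nth_iota.
apply: bigcapT_measurable => k; case: ifP => _; first exact: measurable_coord.
exact: measurableT.
Qed.

(** The conditions are indexed by the countably many windows, and each is a countable union of
    cylinders over admissible words. *)
Lemma measurable_subst_space (zeta : substitution n) :
  measurable (subst_space zeta : set T).
Proof.
pose E (p : int * nat) : set T := [set x | exists (a : 'I_n.+2) (m : nat),
     infix (word_at x p.1 p.2) (iter m (subst_word zeta) [:: a])].
have -> : subst_space zeta = ~` (\bigcup_p ~` E p).
  rewrite setC_bigcup; under eq_bigcapr do rewrite setCK.
  apply/seteqP; split => x /= h; first by move=> [i l] _; exact: h.
  by move=> i l; exact: (h (i, l) I).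
apply: measurableC; apply: countable_bigcupT_measurable; first exact: countableP.
move=> p; apply: measurableC.
have -> : E p = \bigcup_(u : seq 'I_n.+2)
    (if pselect (exists (a : 'I_n.+2) (m : nat), infix u (iter m (subst_word zeta) [:: a]))
     then [set x : T | word_at x p.1 p.2 = u] else set0).
  apply/seteqP; split => x /=.
    by move=> h; exists (word_at x p.1 p.2) => //; case: pselect.
  by move=> [u _]; case: pselect => // h /= e; rewrite /E /= e.
apply: countable_bigcupT_measurable; first exact: countableP.
by move=> u; case: pselect => ? /=; [exact: measurable_word_at|exact: measurable0].
Qed.

Lemma subst_space_shift (zeta : substitution n) (x : seq_space n) (k : int) :
  subst_space zeta (shift_seq k x) <-> subst_space zeta x.
Proof.
suff h y j : subst_space zeta y -> subst_space zeta (shift_seq j y).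
  split; last exact: h.
  move=> /(h _ (- k)); congr subst_space; apply/funext => i.
  by rewrite /shift_seq addrNK.
move=> hy i l; have [a [m aP]] := hy (i + j) l; exists a, m.
have <- : word_at y (i + j) l = word_at (shift_seq j y) i l; last by [].
by apply: eq_map => u; rewrite /shift_seq addrAC.
Qed.

Variables (R : realType) (zeta : substitution n) (mu : probability T R).
Hypothesis muP : invariant_probability zeta mu.
Let X : set T := subst_space zeta.

Lemma integrable_coords (i j : int) (G : 'I_n.+2 -> 'I_n.+2 -> R) :
  mu.-integrable X (EFin \o (fun x : T => G (x i) (x j))).
Proof.
have mX := measurable_subst_space zeta.
apply: measurable_bounded_integrable => //.
- by apply: (le_lt_trans (probability_le1 mu _)) => //; rewrite ltry.
- move=> _ Y mY; apply: measurableI => //.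
  have -> : (fun x : T => G (x i) (x j)) @^-1` Y =
      \bigcup_(p in [set p : 'I_n.+2 * 'I_n.+2 | Y (G p.1 p.2)])
        ([set x : T | x i = p.1] `&` [set x : T | x j = p.2]).
    apply/seteqP; split => x /=; first by move=> Yx; exists (x i, x j).
    by move=> [[a b] /= Yab [-> ->]].
  apply: fin_bigcup_measurable; first exact: finite_finset.
  by move=> p _; apply: measurableI; exact: measurable_coord.
- exists (\sum_a \sum_b `|G a b|); split; first exact: num_real.
  move=> M hM x _; apply: le_trans (ltW hM).
  rewrite (bigD1 (x i))//= (bigD1 (x j))//= -addrA lerDl addr_ge0//.
    by apply: sumr_ge0.
  by apply: sumr_ge0 => a _; apply: sumr_ge0.
Qed.

Lemma Rintegral_coords (i j : int) (G : 'I_n.+2 -> 'I_n.+2 -> R) :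
  \int[mu]_(x in X) G (x i) (x j) =
  \sum_(p : 'I_n.+2 * 'I_n.+2) G p.1 p.2 *
    fine (mu ([set x : T | x i = p.1] `&` [set x : T | x j = p.2] `&` X)).
Proof.
have mX := measurable_subst_space zeta.
have decomp (x : T) : G (x i) (x j) = \sum_(p : 'I_n.+2 * 'I_n.+2)
    G p.1 p.2 * ((x i == p.1) && (x j == p.2))%:R.
  rewrite (bigD1 (x i, x j))//= !eqxx mulr1 big1 ?addr0// => -[a b] /=.
  rewrite xpair_eqE ![_ == x _]eq_sym => /negPf ->.
  by rewrite mulr0.
under eq_Rintegral => x _ do rewrite decomp.
have iI (p : 'I_n.+2 * 'I_n.+2) : mu.-integrable X
   (EFin \o (fun x : T => ((x i == p.1) && (x j == p.2))%:R)).
  exact: (integrable_coords i j (fun a b => ((a == p.1) && (b == p.2))%:R)).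
rewrite Rintegral_sum//; last by move=> p; exact: integrableRZl.
apply: eq_bigr => p _; rewrite RintegralZl//; congr (_ * _).
rewrite /Rintegral -integral_indic//; last first.
  by apply: measurableI; exact: measurable_coord.
congr fine; apply: eq_integral => x _; congr EFin; rewrite indicE.
congr (nat_of_bool _)%:R; apply/idP/idP.
  by move=> /andP[/eqP xi /eqP xj]; rewrite in_setE.
by rewrite in_setE => -[/= -> ->]; rewrite !eqxx.
Qed.

(** Such an integral is a finite sum over cylinders fixing two letters, on which the invariance of
    the measure is applied. *)
Lemma Rintegral_coords_shift (i j : int) (G : 'I_n.+2 -> 'I_n.+2 -> R) (l : nat) :
  \int[mu]_(x in X) G (x (i + l%:Z)) (x (j + l%:Z)) = \int[mu]_(x in X) G (x i) (x j).
Proof.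
have mX := measurable_subst_space zeta.
elim: l => [|l <-]; first by rewrite !addr0.
rewrite !Rintegral_coords; apply: eq_bigr => p _; congr (_ * fine _).
have := muP.2 ([set x : T | x (i + l%:Z) = p.1] `&` [set x : T | x (j + l%:Z) = p.2] `&` X).
move=> <-; last first.
  by apply: measurableI => //; apply: measurableI; exact: measurable_coord.
congr (mu _); apply/seteqP; split => x /=.
  move=> [[x1 x2] Xx]; split; last exact/subst_space_shift.
  by rewrite /shift_seq -!addrA -!PoszD !addn1.
rewrite /shift_seq -!addrA -!PoszD !addn1 => -[[x1 x2] Xx]; split => //.
by move: Xx; rewrite /X -[x in X in X -> _]/(x) => /subst_space_shift.
Qed.

End Cylinders.

(** * Spectral measures of balls *)

Definition cexp (R : realType) (t : R) : R[i] := cos t +i* sin t.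

Lemma cexpD (R : realType) (s t : R) : cexp (s + t) = cexp s * cexp t.
Proof.
apply/eqP; rewrite eq_complex /= cosD sinD eqxx /=.
by rewrite addrC.
Qed.

Lemma cexp0 (R : realType) : cexp (0 : R) = 1.
Proof. by rewrite /cexp cos0 sin0. Qed.

Lemma cexpX (R : realType) (t : R) k : cexp t ^+ k = cexp (k%:R * t).
Proof.
elim: k => [|k IH]; first by rewrite mul0r cexp0.
by rewrite exprS IH -cexpD -[k.+1]add1n natrD mulrDl mul1r.
Qed.

Lemma cnorm_cexp (R : realType) (t : R) : cnorm (cexp t) = 1.
Proof. by rewrite /= cos2Dsin2 sqrtr1. Qed.

Lemma cosD2pi_int (R : realType) (t : R) (m : int) : cos (t + 2 * pi * m%:~R) = cos t.
Proof.
have h (s : R) (k : nat) : cos (s + 2 * pi * k%:R) = cos s.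
  elim: k => [|k IH]; first by rewrite mulr0 addr0.
  rewrite -[k.+1]addn1 natrD mulrDr mulr1 addrA -[RHS]IH.
  by rewrite mulr_natl cosD2pi.
case: m => k; first exact: h.
by rewrite NegzE mulrNz mulrN -[LHS](h _ k.+1) -pmulrn subrK.
Qed.

Lemma sqr_sum_le (R : realDomainType) (I : finType) (t : I -> R) :
  (\sum_a t a) ^+ 2 <= #|I|%:R * \sum_a t a ^+ 2.
Proof.
have -> : (\sum_a t a) ^+ 2 = \sum_a \sum_b t a * t b.
  by rewrite expr2 mulr_suml; apply: eq_bigr => a _; rewrite mulr_sumr.
have e : 2 * (#|I|%:R * \sum_a t a ^+ 2) = \sum_a \sum_b (t a ^+ 2 + t b ^+ 2).
  under [RHS]eq_bigr do rewrite big_split /= sumr_const.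
  by rewrite big_split /= sumr_const sumrMnl -mulr2n -[RHS]mulr_natl; congr (_ * _); rewrite mulr_natl.
rewrite -(@ler_pM2l _ 2)// e mulr_sumr ler_sum// => a _.
rewrite mulr_sumr ler_sum// => b _.
by have := sqr_ge0 (t a - t b); nra.
Qed.

Lemma re_mul_conj (R : realType) (z : R[i]) : complex.Re (z * z^*) = cnorm z ^+ 2.
Proof. by case: z => a b /=; rewrite sqr_sqrtr ?addr_ge0 ?sqr_ge0// mulrN opprK -!expr2. Qed.

Lemma cnorm_sqr (R : rcfType) (z : R[i]) :
  cnorm z ^+ 2 = complex.Re z ^+ 2 + complex.Im z ^+ 2.
Proof. by case: z => a b /=; rewrite sqr_sqrtr ?addr_ge0 ?sqr_ge0. Qed.

Lemma im_sum (R : realType) (I : Type) (s : seq I) (F : I -> R[i]) :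
  complex.Im (\sum_(i <- s) F i) = \sum_(i <- s) complex.Im (F i).
Proof.
elim: s => [|i s IH]; first by rewrite !big_nil.
by rewrite !big_cons -IH; case: (F i) => a b; case: (\sum_(j <- s) F j).
Qed.

Lemma re_sum (R : realType) (I : Type) (s : seq I) (F : I -> R[i]) :
  complex.Re (\sum_(i <- s) F i) = \sum_(i <- s) complex.Re (F i).
Proof.
elim: s => [|i s IH]; first by rewrite !big_nil.
by rewrite !big_cons -IH; case: (F i) => a b; case: (\sum_(j <- s) F j).
Qed.

(** The squared modulus is expanded into the same frequencies [k - l] as [fejer], so that the two
    can be matched term by term. *)
Lemma normsq_double_sum (R : realType) (w : R) (N : nat) (z : nat -> R[i]) :
  cnorm (\sum_(k < N) cexp (- (2 * pi * w)) ^+ k * z k) ^+ 2 =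
  \sum_(k < N) \sum_(l < N)
    (cos (2 * pi * (k%:Z - l%:Z)%:~R * w) * complex.Re (z k * conjc (z l)) +
     sin (2 * pi * (k%:Z - l%:Z)%:~R * w) * complex.Im (z k * conjc (z l))).
Proof.
have reS k : complex.Re (cexp (- (2 * pi * w)) ^+ k * z k) =
    cos (2 * pi * k%:R * w) * complex.Re (z k) + sin (2 * pi * k%:R * w) * complex.Im (z k).
  rewrite cexpX mulrN [cexp _]/cexp cosN sinN; case: (z k) => a b /=.
  by rewrite mulNr opprK; congr (cos _ * _ + sin _ * _); ring.
have imS k : complex.Im (cexp (- (2 * pi * w)) ^+ k * z k) =
    cos (2 * pi * k%:R * w) * complex.Im (z k) - sin (2 * pi * k%:R * w) * complex.Re (z k).
  rewrite cexpX mulrN [cexp _]/cexp cosN sinN; case: (z k) => a b /=.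
  by rewrite mulNr; congr (cos _ * _ - sin _ * _); ring.
rewrite cnorm_sqr re_sum im_sum !expr2 !mulr_suml -big_split; apply: eq_bigr => k _ /=.
rewrite !mulr_sumr -big_split /=; apply: eq_bigr => l _.
rewrite !reS !imS.
have -> : 2 * pi * (k%:Z - l%:Z)%:~R * w = 2 * pi * k%:R * w - 2 * pi * l%:R * w.
  by rewrite rmorphB /= -!pmulrn; ring.
rewrite cosB sinB; case: (z k) => a b; case: (z l) => a' b' /=.
by ring.
Qed.

(** * The Fejer kernel and the mass of a ball *)

Section FejerSigma.
Variables (R : realType) (sigma : {finite_measure set (measurableTypeR R) -> \bar R}).
Let D : set (measurableTypeR R) := `[0, 1[%classic.

Lemma integrable_continuous_bounded (F : R -> R) (M : R) :
  continuous F -> (forall x, `|F x| <= M) -> sigma.-integrable D (EFin \o F).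
Proof.
move=> cF FM; apply: measurable_bounded_integrable.
- exact: measurable_itv.
- by rewrite ltey_eq fin_num_measure//; exact: measurable_itv.
- exact: measurable_funTS (continuous_measurable_fun cF).
- exists M; split; first exact: num_real.
  by move=> M' MM' x _ /=; rewrite (le_trans (FM x))// ltW.
Qed.

Lemma continuous_cosM (q : R) : continuous (fun x : R => cos (q * x)).
Proof.
move=> x; apply: (@continuous_comp _ _ _ (fun x => q * x) cos).
  exact: mulrl_continuous.
exact: continuous_cos.
Qed.

Lemma continuous_sinM (q : R) : continuous (fun x : R => sin (q * x)).
Proof.
move=> x; apply: (@continuous_comp _ _ _ (fun x => q * x) sin).
  exact: mulrl_continuous.
exact: continuous_sin.
Qed.

(** This is [N] times the classical Fejer kernel centred at [w], written so that its integral
    involves only the Fourier coefficients of [sigma]. *)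
Definition fejer (w : R) (N : nat) (x : R) : R :=
  \sum_(k < N) \sum_(l < N)
    (cos (2 * pi * (k%:Z - l%:Z)%:~R * w) * cos (2 * pi * (k%:Z - l%:Z)%:~R * x) +
     sin (2 * pi * (k%:Z - l%:Z)%:~R * w) * sin (2 * pi * (k%:Z - l%:Z)%:~R * x)).

Lemma integrable_cosM (q : R) : sigma.-integrable D (EFin \o (fun x => cos (q * x))).
Proof.
by apply: (@integrable_continuous_bounded _ 1) => [|x]; [exact: continuous_cosM|exact: cos_max].
Qed.

Lemma integrable_sinM (q : R) : sigma.-integrable D (EFin \o (fun x => sin (q * x))).
Proof.
by apply: (@integrable_continuous_bounded _ 1) => [|x]; [exact: continuous_sinM|exact: sin_max].
Qed.

Lemma integrable_fejer_term (c s q : R) :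
  sigma.-integrable D (EFin \o (fun x => c * cos (q * x) + s * sin (q * x))).
Proof.
have mD : measurable D by exact: measurable_itv.
have -> : EFin \o (fun x => c * cos (q * x) + s * sin (q * x)) =
    ((EFin \o (fun x : R => (c * cos (q * x))%R)) \+
     (EFin \o (fun x : R => (s * sin (q * x))%R)))%E by [].
apply: integrableD => //; apply: integrableRZl => //.
  exact: integrable_cosM.
exact: integrable_sinM.
Qed.

Lemma integrable_fejer (w : R) (N : nat) : sigma.-integrable D (EFin \o fejer w N).
Proof.
have mD : measurable D by exact: measurable_itv.
apply: integrable_Rsum => // k; apply: integrable_Rsum => // l.
exact: integrable_fejer_term.
Qed.

Lemma Rintegral_fejer (w : R) (N : nat) :
  \int[sigma]_(x in D) fejer w N x =
  \sum_(k < N) \sum_(l < N)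
    (cos (2 * pi * (k%:Z - l%:Z)%:~R * w) *
       \int[sigma]_(x in D) cos (2 * pi * (k%:Z - l%:Z)%:~R * x) +
     sin (2 * pi * (k%:Z - l%:Z)%:~R * w) *
       \int[sigma]_(x in D) sin (2 * pi * (k%:Z - l%:Z)%:~R * x)).
Proof.
have mD : measurable D by exact: measurable_itv.
rewrite Rintegral_sum//; last first.
  by move=> k; apply: integrable_Rsum => // l; exact: integrable_fejer_term.
apply: eq_bigr => k _; rewrite Rintegral_sum//; last first.
  by move=> l; exact: integrable_fejer_term.
apply: eq_bigr => l _; rewrite RintegralD//; last 2 first.
- by apply: integrableRZl => //; exact: integrable_cosM.
- by apply: integrableRZl => //; exact: integrable_sinM.
by congr (_ + _); rewrite RintegralZl//; [exact: integrable_cosM|exact: integrable_sinM].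
Qed.

Lemma fejerE (w : R) (N : nat) (x : R) :
  fejer w N x = (\sum_(k < N) cos (2 * pi * k%:R * (x - w))) ^+ 2 +
                (\sum_(k < N) sin (2 * pi * k%:R * (x - w))) ^+ 2.
Proof.
rewrite !expr2 !mulr_suml -big_split /fejer; apply: eq_bigr => k _ /=.
rewrite !mulr_sumr -big_split /=; apply: eq_bigr => l _.
rewrite [LHS](_ : _ = cos (2 * pi * (k%:Z - l%:Z)%:~R * x - 2 * pi * (k%:Z - l%:Z)%:~R * w)).
  rewrite -cosB; congr cos; rewrite rmorphB /= -!pmulrn; ring.
by rewrite cosB addrC [X in X + _]mulrC [X in _ + X]mulrC addrC.
Qed.

Lemma fejer_ge0 w N x : 0 <= fejer w N x.
Proof. by rewrite fejerE addr_ge0 ?sqr_ge0. Qed.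

(** On the ball all phases are at most 1 in absolute value modulo [2 * pi], so each cosine is at
    least [cos 1 > 0]; the square of the sine sum is dropped. *)
Lemma fejer_ball_ge (w r : R) (N : nat) (x : R) (m : int) :
  2 * pi * N%:R * r <= 1 -> `|x - w - m%:~R| < r ->
  (cos 1 * N%:R) ^+ 2 <= fejer w N x.
Proof.
move=> Nr xr; have pi0 := pi_gt0 R; have pi2 := pi_ge2 R.
have c1 : 0 < cos 1 :> R := cos1_gt0 R.
have cosk (k : 'I_N) : cos 1 <= cos (2 * pi * k%:R * (x - w)).
  have -> : cos (2 * pi * k%:R * (x - w)) = cos `|2 * pi * k%:R * (x - w - m%:~R)|.
    rewrite cos_norm -[RHS](cosD2pi_int _ (k%:Z * m)) rmorphM /= -pmulrn.
    by congr cos; ring.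
  have le1 : `|2 * pi * k%:R * (x - w - m%:~R)| <= 1.
    rewrite normrM ger0_norm ?mulr_ge0 ?(ltW pi0)//; apply: le_trans Nr.
    rewrite ler_pM ?mulr_ge0 ?(ltW pi0) ?(ltW xr)// ler_wpM2l ?mulr_ge0 ?(ltW pi0)//.
    by rewrite ler_nat ltnW.
  rewrite le_eqVlt; have [->|ne] := eqVneq `|2 * pi * k%:R * (x - w - m%:~R)| 1.
    by rewrite eqxx.
  apply/orP; right; rewrite ltr_cos ?in_itv /= ?normr_ge0 ?ler01 //=.
  - by rewrite lt_neqAle ne.
  - by move: pi2; lra.
  - by move: le1 pi2; lra.
rewrite fejerE -[leLHS]addr0 lerD ?sqr_ge0//.
have sum_ge : cos 1 * N%:R <= \sum_(k < N) cos (2 * pi * k%:R * (x - w)).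
  have -> : cos 1 * N%:R = \sum_(k < N) cos 1 :> R.
    by rewrite sumr_const card_ord mulr_natr.
  by apply: ler_sum => k _.
have N0 : 0 <= cos 1 * N%:R :> R by rewrite mulr_ge0// ltW.
by rewrite ler_sqr ?nnegrE// (le_trans N0).
Qed.

Lemma measurable_circle_ball (w r : R) : measurable (circle_ball w r).
Proof.
have -> : circle_ball w r = (`[0, 1[%classic : set R) `&`
    \bigcup_(m in @setT int) ball (w + m%:~R) r.
  apply/seteqP; split => x /=; rewrite /circle_ball /= in_itv /=.
    move=> [-> [m hm]]; split => //; exists m => //.
    by rewrite -ball_normE /= distrC opprD addrA.
  move=> [-> [m _]]; rewrite -ball_normE /= distrC opprD addrA => hm.
  by split => //; exists m.
apply: measurableI; first exact: measurable_itv.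
by apply: open_measurable; apply: bigcup_open => m _; exact: ball_open.
Qed.

(** Markov's inequality for the kernel, which is nonnegative and bounded below on the ball. *)
Lemma sigma_ball_fejer (w r : R) (N : nat) :
  2 * pi * N%:R * r <= 1 ->
  (((cos 1 * N%:R) ^+ 2)%:E * sigma (circle_ball w r) <=
   (\int[sigma]_(x in D) fejer w N x)%:E)%E.
Proof.
move=> Nr.
have iK : sigma.-integrable D (EFin \o fejer w N) := integrable_fejer w N.
have mB := measurable_circle_ball w r.
rewrite /Rintegral fineK; last first.
  by rewrite (integrable_fin_num _ iK)//; exact: measurable_itv.
rewrite -integral_cst//.
have mK : measurable_fun D (EFin \o fejer w N) by case/integrableP: iK.
have BD : circle_ball w r `<=` D by move=> x [x01 _]; rewrite /D /= ?in_itv.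
apply: (@le_trans _ _ (\int[sigma]_(x in circle_ball w r) (fejer w N x)%:E)%E).
  apply: ge0_le_integral => //.
  - by move=> x _ /=; rewrite lee_fin sqr_ge0.
  - by apply: measurable_funS BD mK; exact: measurable_itv.
  - by move=> x [_ [m hm]] /=; rewrite lee_fin (fejer_ball_ge Nr hm).
apply: ge0_subset_integral => //; first exact: measurable_itv.
by move=> x _; rewrite lee_fin fejer_ge0.
Qed.

End FejerSigma.

(** * From twisted sums to spectral measures *)

Section SpectralBound.
Variables (R : realType) (n : nat) (zeta : substitution n).
Variables (mu : probability (borel_seq_space n) R) (muP : invariant_probability zeta mu).
Variables (f : borel_seq_space n -> R[i]) (fP : cylindrical0 zeta f).
Variables (sigma : {finite_measure set (measurableTypeR R) -> \bar R}).
Hypothesis sigmaP : spectral_measure zeta mu f sigma.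

Let X : set (borel_seq_space n) := subst_space zeta.

Lemma cylindrical0_letter : exists c : 'I_n.+2 -> R[i], forall x, X x -> f x = c (x 0).
Proof.
have /choice[c cP] : forall a : 'I_n.+2, exists z : R[i], forall x, X x -> x 0 = a -> f x = z.
  move=> a; have [[y [Xy ya]]|h] := pselect (exists y, X y /\ y 0 = a).
    by exists (f y) => x Xx xa; apply: fP => //; rewrite xa ya.
  (* The value 0 is a default for a letter that no point of the space has at index 0. *)
  by exists 0 => x Xx xa; exfalso; apply: h; exists x.
by exists c => x Xx; exact: cP.
Qed.

(** The Fourier coefficient of order [k - l] is a correlation of [f]; shifting by [l] makes it a
    correlation of the coordinates [k] and [l], and the double sum becomes a squared modulus. *)
Lemma Rintegral_fejer_letter (c : 'I_n.+2 -> R[i]) (w : R) (N : nat) :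
  (forall x, X x -> f x = c (x 0)) ->
  \int[sigma]_(x in `[0, 1[%classic) fejer w N x =
  \int[mu]_(x in X) cnorm (\sum_(k < N) cexp (- (2 * pi * w)) ^+ k * c (x k%:Z)) ^+ 2.
Proof.
move=> fc; have mX := measurable_subst_space zeta.
have shiftE (x : borel_seq_space n) (q : int) : X x -> f (shift_seq q x) = c (x q).
  move=> Xx; rewrite fc; last exact/subst_space_shift.
  by rewrite /shift_seq add0r.
pose A (a b : 'I_n.+2) : R := complex.Re (c a * conjc (c b)).
pose B (a b : 'I_n.+2) : R := complex.Im (c a * conjc (c b)).
have spec_re (k l : nat) : \int[sigma]_(x in `[0, 1[%classic)
    cos (2 * pi * (k%:Z - l%:Z)%:~R * x) = \int[mu]_(x in X) A (x k%:Z) (x l%:Z).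
  have /(congr1 (@complex.Re R)) := sigmaP.2 (k%:Z - l%:Z).
  rewrite /L2_inner /Cintegral /= => ->.
  have := Rintegral_coords_shift muP (k%:Z - l%:Z) 0 A l.
  rewrite subrK add0r => ->; apply: eq_Rintegral => x; rewrite in_setE => Xx.
  by rewrite shiftE// fc.
have spec_im (k l : nat) : \int[sigma]_(x in `[0, 1[%classic)
    sin (2 * pi * (k%:Z - l%:Z)%:~R * x) = \int[mu]_(x in X) B (x k%:Z) (x l%:Z).
  have /(congr1 (@complex.Im R)) := sigmaP.2 (k%:Z - l%:Z).
  rewrite /L2_inner /Cintegral /= => ->.
  have := Rintegral_coords_shift muP (k%:Z - l%:Z) 0 B l.
  rewrite subrK add0r => ->; apply: eq_Rintegral => x; rewrite in_setE => Xx.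
  by rewrite shiftE// fc.
rewrite Rintegral_fejer.
pose G (k l : nat) (a b : 'I_n.+2) : R :=
  cos (2 * pi * (k%:Z - l%:Z)%:~R * w) * A a b + sin (2 * pi * (k%:Z - l%:Z)%:~R * w) * B a b.
transitivity (\sum_(k < N) \sum_(l < N) \int[mu]_(x in X) G k l (x k%:Z) (x l%:Z)).
  apply: eq_bigr => k _; apply: eq_bigr => l _.
  have iA : mu.-integrable X (EFin \o (fun x => A (x k%:Z) (x l%:Z))) := integrable_coords zeta mu k l A.
  have iB : mu.-integrable X (EFin \o (fun x => B (x k%:Z) (x l%:Z))) := integrable_coords zeta mu k l B.
  rewrite RintegralD//; [|exact: integrableRZl..].
  by rewrite spec_re spec_im !RintegralZl.
under eq_bigr => k _.
  rewrite -Rintegral_sum//; last by move=> l; exact: (integrable_coords zeta mu k l (G k l)).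
  over.
rewrite -Rintegral_sum//; last first.
  move=> k; apply: integrable_Rsum => // l.
  exact: (integrable_coords zeta mu k l (G k l)).
apply: eq_Rintegral => x _.
by rewrite (normsq_double_sum _ _ (fun k => c (x k%:Z))).
Qed.

Lemma L2_normsqE (c : 'I_n.+2 -> R[i]) : (forall x, X x -> f x = c (x 0)) ->
  L2_normsq zeta mu f = \int[mu]_(x in X) cnorm (c (x 0)) ^+ 2.
Proof.
move=> fc; rewrite /L2_normsq /L2_inner /Cintegral /=.
by apply: eq_Rintegral => x; rewrite in_setE => Xx; rewrite re_mul_conj fc.
Qed.

(** Splitting by letters and Cauchy-Schwarz lead to the squares [S a ^+ 2]. One factor is at most
    [Bd], the other at most the number of occurrences of [a]. Weighted by the squared moduli of
    [c a], these numbers add up to the sum of the [V k], which integrates to [N] times the squared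
    norm. *)
Lemma spectral_measure_ball_le (w r Bd : R) (N : nat) :
  (forall x, X x -> forall a,
    cnorm (twisted_sum (cexp (- (2 * pi * w))) a (word_at x 0 N)) <= Bd) ->
  2 * pi * N%:R * r <= 1 ->
  (((cos 1 * N%:R) ^+ 2)%:E * sigma (circle_ball w r) <=
   (n.+2%:R * Bd * N%:R * L2_normsq zeta mu f)%:E)%E.
Proof.
move=> hBd Nr; apply: (le_trans (sigma_ball_fejer sigma w Nr)).
have [c fc] := cylindrical0_letter; have mX := measurable_subst_space zeta.
rewrite lee_fin (Rintegral_fejer_letter _ _ fc) (L2_normsqE fc).
set e := cexp _.
pose V (k : nat) (x : borel_seq_space n) : R := cnorm (c (x k%:Z)) ^+ 2.
have iV k : mu.-integrable X (EFin \o V k).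
  exact: (integrable_coords zeta mu k k (fun a _ => cnorm (c a) ^+ 2)).
have VE k : \int[mu]_(x in X) V k x = \int[mu]_(x in X) V 0%N x.
  have := Rintegral_coords_shift muP 0 0 (fun a _ => cnorm (c a) ^+ 2) k.
  by rewrite !add0r.
have -> : n.+2%:R * Bd * N%:R * (\int[mu]_(x in X) cnorm (c (x 0)) ^+ 2) =
    \int[mu]_(x in X) (n.+2%:R * Bd * \sum_(k < N) V k x).
  rewrite RintegralZl//; last exact: integrable_Rsum.
  rewrite Rintegral_sum//; under eq_bigr do rewrite VE.
  by rewrite sumr_const card_ord -mulrA; congr (_ * _); rewrite mulr_natl.
have iS : mu.-integrable X (EFin \o (fun x => cnorm (\sum_(k < N) e ^+ k * c (x k%:Z)) ^+ 2)).
  pose A (a b : 'I_n.+2) : R := complex.Re (c a * conjc (c b)).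
  pose B (a b : 'I_n.+2) : R := complex.Im (c a * conjc (c b)).
  pose G (k l : nat) (a b : 'I_n.+2) : R :=
    cos (2 * pi * (k%:Z - l%:Z)%:~R * w) * A a b + sin (2 * pi * (k%:Z - l%:Z)%:~R * w) * B a b.
  have -> : (fun x : borel_seq_space n => cnorm (\sum_(k < N) e ^+ k * c (x k%:Z)) ^+ 2) =
      (fun x => \sum_(k < N) \sum_(l < N) G k l (x k%:Z) (x l%:Z)).
    by apply/funext => x; rewrite (normsq_double_sum _ _ (fun k => c (x k%:Z))).
  apply: integrable_Rsum => // k; apply: integrable_Rsum => // l.
  exact: (integrable_coords zeta mu k l (G k l)).
apply: le_Rintegral => //.
  by apply: integrableRZl => //; exact: integrable_Rsum.
move=> x Xx.
pose S a : R := cnorm (\sum_(k < N) e ^+ k * (x k%:Z == a)%:R).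
have S0 a : 0 <= S a by exact: cnorm_ge0.
have SB a : S a <= Bd.
  have := hBd x Xx a; rewrite /word_at twisted_sum_mkseq.
  by under eq_bigr do rewrite add0r.
have Scount a : S a <= \sum_(k < N) (x k%:Z == a)%:R.
  apply: (le_trans (ler_cnorm_sum _ _ _)); apply: ler_sum => k _.
  rewrite cnormM cnormX cnorm_cexp expr1n mul1r.
  by case: (_ == _); [rewrite [cnorm _]Normc.normc1|rewrite [cnorm _]cnorm0].
have Bd0 : 0 <= Bd := le_trans (S0 ord0) (SB ord0).
have step1 : cnorm (\sum_(k < N) e ^+ k * c (x k%:Z)) <= \sum_a cnorm (c a) * S a.
  have -> : \sum_(k < N) e ^+ k * c (x k%:Z) =
      \sum_a c a * \sum_(k < N) e ^+ k * (x k%:Z == a)%:R.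
    under [RHS]eq_bigr do rewrite mulr_sumr.
    rewrite exchange_big; apply: eq_bigr => k _ /=.
    rewrite (bigD1 (x k%:Z))//= eqxx mulr1 mulrC big1 ?addr0// => a ax.
    by rewrite eq_sym (negPf ax) !mulr0.
  apply: (le_trans (ler_cnorm_sum _ _ _)); apply: ler_sum => a _.
  by rewrite cnormM.
apply: (@le_trans _ _ ((\sum_a cnorm (c a) * S a) ^+ 2)).
  by rewrite ler_sqr ?nnegrE ?cnorm_ge0// sumr_ge0// => a _; rewrite mulr_ge0 ?cnorm_ge0.
apply: (le_trans (sqr_sum_le _)); rewrite card_ord -mulrA ler_wpM2l//.
have -> : \sum_(k < N) V k x = \sum_a cnorm (c a) ^+ 2 * \sum_(k < N) (x k%:Z == a)%:R.
  under [RHS]eq_bigr do rewrite mulr_sumr.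
  rewrite exchange_big; apply: eq_bigr => k _ /=.
  rewrite (bigD1 (x k%:Z))//= eqxx mulr1 big1 ?addr0// => a ax.
  by rewrite eq_sym (negPf ax) !mulr0.
rewrite mulr_sumr; apply: ler_sum => a _.
by rewrite exprMn [leRHS]mulrCA ler_wpM2l ?sqr_ge0// expr2 ler_pM.
Qed.

End SpectralBound.

(** * Conclusion *)

(* Balance the level j against the length N: with N of order 1/r and E^(2j) of order 1/r. *)
Lemma balance_level (R : realType) (c A E rho : R) :
  0 <= c -> 0 <= A -> 1 < E -> 0 < rho < 1 ->
  exists r0 theta : R, [/\ 0 < r0, 0 < theta & forall r, 0 < r < r0 ->
    exists j N : nat, [/\ (0 < N)%N, 2 * pi * N%:R * r <= 1 &
      c * (A * E ^+ j / N%:R + rho ^+ j) <= r `^ theta]].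
Proof.
have arith (y J th q e : R) : q * y <= q * (J + 1) -> y * (th * (2 * e)) <= y * q ->
    J * - q <= q + - (th * (y * (2 * e))).
  by move=> h1 h2; lra.
have arith2 (M t th : R) : 2 * M < t * th -> M <= 1 + th / 2 * t by move=> h; lra.
have arith3 (th t : R) : th / 2 * t + - (th * t) <= - (th / 2 * t) by lra.
move=> c0 A0 E1 /andP[rho0 rho1].
pose e := ln E; pose q := - ln rho.
have e0 : 0 < e by rewrite ln_gt0.
have q0 : 0 < q by rewrite oppr_gt0 ln_lt0// rho0.
have EE : E = expR e by rewrite lnK// posrE (lt_trans ltr01).
have rhoE : rho = expR (- q) by rewrite opprK lnK.
(* With [E ^+ (2 * j)] about [1 / r], the term [E ^+ j / N] has order [r] to the power 1/2, and
   [rho ^+ j] has order [r] to the power [q / (2 * e)]. *)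
pose theta2 := Num.min (2^-1) (q / (2 * e)).
have th0 : 0 < theta2 by rewrite lt_min invr_gt0 ltr0n divr_gt0// mulr_gt0.
have th1 : theta2 <= 2^-1 by rewrite ge_min lexx.
have th2 : theta2 * (2 * e) <= q by rewrite -ler_pdivlMr ?mulr_gt0// ge_min lexx orbT.
(* [M] collects all constants. Half of the exponent [theta2] is sacrificed to absorb it, which holds
   once [- ln r] exceeds [2 * M / theta2]. *)
pose M := c * (16 * A + expR q).
have M0 : 0 <= M by rewrite mulr_ge0// addr_ge0 ?expR_ge0// mulr_ge0.
exists (Num.min 8^-1 (expR (- (2 * M / theta2)))), (theta2 / 2); split.
- by rewrite lt_min invr_gt0 ltr0n expR_gt0.
- by rewrite divr_gt0.
move=> r /andP[r0]; rewrite lt_min => /andP[r8 rM].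
pose t := - ln r.
have rE : r = expR (- t) by rewrite opprK lnK.
have tM : 2 * M / theta2 < t.
  by move: rM; rewrite {1}rE ltr_expR ltrN2.
have t0 : 0 < t by apply: le_lt_trans tM; rewrite divr_ge0 ?(ltW th0)// mulr_ge0.
pose y := t / (2 * e).
have y0 : 0 <= y by rewrite divr_ge0 ?(ltW t0)// mulr_ge0 ?(ltW e0).
have tE : t = y * (2 * e) by rewrite divfK// mulf_neq0// gt_eqF.
pose j := Num.truncn y.
have /andP[jy yj] := truncn_itv y0; rewrite -/j in jy yj.
have r8' : 1 <= (8 * r)^-1.
  rewrite invf_ge1 ?mulr_gt0//; move: r8; lra.
(* The factor 8 exceeds [2 * pi], which gives the phase condition; [r < 1 / 8] makes [N] positive
   and at least [1 / (16 * r)]. *)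
pose N := Num.truncn (8 * r)^-1.
have N0 : (0 < N)%N by rewrite truncn_gt0.
have /andP[Nr rN] := truncn_itv (le_trans ler01 r8'); rewrite -/N in Nr rN.
have N0R : 0 < N%:R :> R by rewrite ltr0n.
have Nr8 : N%:R * (8 * r) <= 1 by rewrite -ler_pdivlMr ?mulr_gt0// div1r.
have Nr16 : 1 <= 16 * r * N%:R.
  have h : 1 < N.+1%:R * (8 * r) by rewrite -ltr_pdivrMr ?mulr_gt0// div1r.
  have N1 : 1 <= N%:R :> R by rewrite ler1n.
  by move: h; rewrite -natr1; nra.
exists j, N; split => //.
  have pi4 : pi / 2 < 2 :> R := pihalf_lt2 R.
  have Nrpos : 0 <= N%:R * r by rewrite mulr_ge0// ltW.
  by move: Nr8; nra.
have -> : r `^ (theta2 / 2) = expR (- (theta2 / 2 * t)).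
  by rewrite /powR gt_eqF// /t mulrN opprK.
have b1 : A * E ^+ j / N%:R <= 16 * A * expR (- (theta2 * t)).
  rewrite ler_pdivrMr//.
  have Ej : E ^+ j <= expR (t / 2).
    by rewrite EE -expRM_natl ler_expR tE; move: jy e0; nra.
  have rEj : expR (t / 2) * r <= expR (- (theta2 * t)).
    have h : theta2 * t <= 2^-1 * t by rewrite ler_wpM2r// ltW.
    by rewrite [X in _ * X]rE -expRD ler_expR; clear -h; lra.
  have h1 : A * E ^+ j <= A * expR (t / 2) by rewrite ler_wpM2l.
  apply: (le_trans h1).
  have h2 : A * expR (t / 2) <= A * expR (t / 2) * (16 * r * N%:R).
    by rewrite ler_peMr// mulr_ge0// expR_ge0.
  apply: (le_trans h2).
  have -> : A * expR (t / 2) * (16 * r * N%:R) = (16 * A * N%:R) * (expR (t / 2) * r) by ring.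
  have -> : 16 * A * expR (- (theta2 * t)) * N%:R = (16 * A * N%:R) * expR (- (theta2 * t)) by ring.
  by rewrite ler_wpM2l// !mulr_ge0.
have b2 : rho ^+ j <= expR q * expR (- (theta2 * t)).
  rewrite rhoE -expRM_natl -expRD ler_expR tE.
  move: yj; rewrite -natr1 => yj.
  by apply: arith; [rewrite ler_wpM2l// ltW|rewrite ler_wpM2l].
have b3 : M <= expR (theta2 / 2 * t).
  have h : 2 * M < t * theta2 by rewrite -ltr_pdivrMr.
  by apply: (le_trans _ (expR_ge1Dx _)); exact: arith2.
have b4 : c * (A * E ^+ j / N%:R + rho ^+ j) <= M * expR (- (theta2 * t)).
  by rewrite /M -[leRHS]mulrA ler_wpM2l// mulrDl lerD.
apply: (le_trans b4); apply: (@le_trans _ _ (expR (theta2 / 2 * t) * expR (- (theta2 * t)))).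
  by rewrite ler_wpM2r// expR_ge0.
by rewrite -expRD ler_expR arith3.
Qed.

(** The squared modulus is [2 + 2 * cos (2 * pi * t)], and the cosine decreases with the distance of
    [t] to the nearest integer. *)
Lemma cnorm_1cexp_gap (R : realType) (delta : R) : 0 < delta ->
  exists eta : R, [/\ 0 < eta, eta <= 1 & forall t,
    (forall m : int, delta <= `|t - m%:~R|) -> cnorm (1 + cexp (2 * pi * t)) <= 2 - eta].
Proof.
move=> delta0; pose d := Num.min delta 2^-1.
have d0 : 0 < d by rewrite lt_min delta0 invr_gt0 ltr0n.
have d2 : d <= 2^-1 by rewrite ge_min lexx orbT.
have dd : d <= delta by rewrite ge_min lexx.
have pi0 := pi_gt0 R.
have cd : cos (2 * pi * d) < 1.
  have p1 : 0 < 2 * pi * d by rewrite !mulr_gt0.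
  have p2 : 2 * pi * d <= pi by clear -d2 pi0; nra.
  have z0 : (0 : R) \in `[0, pi] by rewrite in_itv /= lexx ltW.
  have zd : 2 * pi * d \in `[0, pi] by rewrite in_itv /= p2 ltW.
  by rewrite -[ltRHS]cos0 (ltr_cos z0 zd).
have cd1 := cos_geN1 (2 * pi * d).
pose kappa := Num.sqrt (2 + 2 * cos (2 * pi * d)).
have k2 : kappa < 2.
  have -> : 2 = Num.sqrt (2 ^+ 2) :> R by rewrite sqrtr_sqr ger0_norm.
  by rewrite ltr_sqrt; move: cd; lra.
exists (Num.min 1 (2 - kappa)); split.
- by rewrite lt_min ltr01 subr_gt0.
- by rewrite ge_min lexx.
move=> t ht; apply: (@le_trans _ _ kappa); last first.
  have : Num.min 1 (2 - kappa) <= 2 - kappa by rewrite ge_min lexx orbT.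
  lra.
pose m := Num.floor (t + 2^-1); pose s := t - m%:~R.
have /andP[m1 m2] := floor_itv (t + 2^-1); rewrite -/m rmorphD /= in m1 m2.
have sd : d <= `|s| by apply: le_trans dd _; exact: ht.
have s2 : `|s| <= 2^-1 by rewrite ler_norml /s; move: m1 m2; lra.
have cs : cos (2 * pi * t) = cos `|2 * pi * s|.
  by rewrite cos_norm -[RHS](cosD2pi_int _ m); congr cos; rewrite /s; ring.
have cle : cos (2 * pi * t) <= cos (2 * pi * d).
  have ns : `|2 * pi * s| = 2 * pi * `|s| by rewrite normrM ger0_norm// mulr_ge0// ltW.
  rewrite cs ns; have [->//|ne] := eqVneq d `|s|.
  have p1 : 2 * pi * d <= pi by clear -d2 pi0; nra.
  have p2 : 2 * pi * `|s| <= pi.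
    by move: `|s| s2 => u s2; clear -s2 pi0; nra.
  have p3 : 0 <= 2 * pi * d by rewrite !mulr_ge0 ?(ltW pi0) ?(ltW d0).
  have p4 : 0 <= 2 * pi * `|s| by rewrite !mulr_ge0 ?(ltW pi0).
  have zd : 2 * pi * d \in `[0, pi] by rewrite in_itv /= p1 p3.
  have zs : 2 * pi * `|s| \in `[0, pi] by rewrite in_itv /= p2 p4.
  by rewrite ltW// (ltr_cos zd zs) ltr_pM2l ?mulr_gt0// lt_neqAle ne.
have -> : cnorm (1 + cexp (2 * pi * t)) = Num.sqrt (2 + 2 * cos (2 * pi * t)).
  rewrite /=; congr Num.sqrt; have := cos2Dsin2 (2 * pi * t).
  move: (cos _) (sin _) => u v uv; rewrite add0r.
  by clear -uv; lra.
by rewrite ler_wsqrtr// lerD2l ler_wpM2l.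
Qed.

(** Maximality of the modulus identifies the Salem number of [salem_type] with [alpha]. Its minimal
    polynomial and [chi] are irreducible with a common root, so they divide each other and have the
    same roots. *)
Lemma salem_char_poly (R : realType) n (zeta : substitution n) (alpha : R)
    (chi := char_poly (subst_mx zeta)) :
  salem_type R zeta -> perron_frobenius_eigenvalue (subst_mx zeta) alpha ->
  [/\ root (map_poly intr chi) alpha, 1 < alpha,
    forall z : R[i], root (map_poly intr chi) z -> z != alpha%:C -> `|z| <= 1 &
    exists z : R[i], root (map_poly intr chi) z /\ `|z| = 1].
Proof.
move=> [irchi [beta [[eb maxb] [b1 [p [pm irp pb p1 pu]]]]]] [ea maxa].
have toroot (F : fieldType) (z : F) :
    eigenvalue (map_mx intr (subst_mx zeta)) z = root (map_poly intr chi) z.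
  by rewrite eigenvalue_root_char /chi map_char_poly.
have eq_ab : beta = alpha.
  have le_norm (x y : R) : root (map_poly intr chi) x ->
      (forall z : R[i], eigenvalue (map_mx intr (subst_mx zeta)) z -> `|z| <= y%:C) -> x <= y.
    move=> rx /(_ x%:C); rewrite toroot root_real_complex => /(_ rx).
    by rewrite -cnormE lecR cnorm_real; apply: le_trans; exact: ler_norm.
  by apply/eqP; rewrite eq_le !le_norm// -toroot.
subst beta.
have ra : root (map_poly intr chi) alpha by rewrite -toroot.
have dvd1 : pQ p %| pQ chi.
  by apply: (irreducible_dvdp_root irp pb); rewrite map_poly_ratr_intr.
have dvd2 : pQ chi %| pQ p.
  by apply: (irreducible_dvdp_root irchi ra); rewrite map_poly_ratr_intr.
split => //.
- move=> z rz; apply: p1; rewrite -map_poly_ratr_intr.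
  exact: dvdp_root_ratr dvd2 rz.
- have [z [rz z1]] := pu; exists z; split => //; rewrite -map_poly_ratr_intr.
  exact: dvdp_root_ratr dvd1 rz.
Qed.

(** The denominator does not vanish at [alpha], so it can be inverted modulo [p]. *)
Lemma in_Q_adjoin_poly (R : realType) (p : {poly int}) (alpha w : R) :
  irreducible_poly (pQ p) -> root (map_poly intr p) alpha -> in_Q_adjoin alpha w ->
  exists g : {poly rat}, (map_poly ratr g).[alpha] = w.
Proof.
move=> irp pa [s [q [q0 ->]]].
have [v pdiv] := inverse_mod_irreducible irp pa q0.
exists (s * v); have := dvdp_root_ratr pdiv pa.
rewrite rootE rmorphB rmorph1 !rmorphM /= !hornerE subr_eq0 => /eqP vq.
by congr (_ * _); apply: (mulIf q0); rewrite vq mulVf.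
Qed.

Lemma not_is_integer01 (R : realType) (w : R) : 0 < w < 1 -> ~ is_integer w.
Proof.
move=> w01 [m mE]; move: w01; rewrite mE ltr0z ltrz1 => /andP[].
by clear; lia.
Qed.

Lemma twisted_sum_decay (R : realType) n (zeta : substitution n) (alpha w : R) :
  primitive_subst zeta -> salem_type R zeta -> irreducible_char_poly zeta ->
  perron_frobenius_eigenvalue (subst_mx zeta) alpha ->
  0 < w < 1 -> in_Q_adjoin alpha w ->
  exists A E rho : R, [/\ 0 <= A, 1 < E, 0 < rho < 1 &
    forall (j N : nat) x (a : 'I_n.+2), subst_space zeta x ->
      cnorm (twisted_sum (cexp (- (2 * pi * w))) a (word_at x 0 N)) <=
      A * E ^+ j + rho ^+ j * N%:R].
Proof.
move=> prim salem irchi pf w01 wQ.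
have [ra a1 rz_le1 rz_eq1] := salem_char_poly salem pf.
have [g gw] := in_Q_adjoin_poly irchi ra wQ.
have wN := not_is_integer01 w01.
have [m [b [a [v [y1 [y2 [retE wv]]]]]]] := return_word_nonintegral irchi ra a1 prim wN.
pose u k : int := (size (iter_subst zeta k (a :: v)))%:Z.
have [delta [L [delta0 synd]]] := salem_syndetic (char_poly_monic (subst_mx zeta)) irchi ra a1
   rz_le1 rz_eq1 gw (u := u) (size_iter_recurrence zeta (a :: v)) isT
   (fun k => introN eqP (fun e => wv (ex_intro _ k e))).
have [eta [eta0 eta1 gap]] := cnorm_1cexp_gap delta0.
have [p pP] := primitive_mem prim.
have x1 : cnorm (cexp (- (2 * pi * w))) = 1 by exact: cnorm_cexp.
(* The return word found in the image of [b] appears in the image of every letter, since [b] occurs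
   in each image of level [p]. *)
have return_q c : exists y1 y2 : seq 'I_n.+2,
    iter_subst zeta (m + p) [:: c] = y1 ++ (a :: v) ++ a :: y2.
  rewrite iter_substD; have /splitPr[v1 v2] := pP b c.
  exists (iter_subst zeta m v1 ++ y1), (y2 ++ iter_subst zeta m v2).
  by rewrite iter_subst_cat (iter_subst_cons _ m b v2) retE -!catA.
have syndetic k0 : exists2 k, (k0 <= k < k0 + L)%N &
    cnorm (1 + cexp (- (2 * pi * w)) ^+ size (iter_subst zeta k (a :: v))) <= 2 - eta.
  have [k kL kd] := synd k0; exists k => //; rewrite cexpX.
  have -> : (size (iter_subst zeta k (a :: v)))%:R * - (2 * pi * w) =
      2 * pi * - (w * (size (iter_subst zeta k (a :: v)))%:R) by ring.
  apply: gap => l; have -> : forall s t : R, `|- s - t| = `|s - - t|.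
    by move=> s t; rewrite -normrN opprD !opprK.
  by rewrite -rmorphN; exact: kd.
have [rho rho01 decay] := level_bound_decay x1 eta0 eta1 return_q syndetic pP.
have [K K1 szK] := size_iter_le zeta.
pose P := (L + (m + p))%N.
have P0 : (0 < P)%N.
  by rewrite /P; have [k /andP[k1 k2] _] := synd 0%N; lia.
(* The two truncated ends at level [p + j * P] cost at most [2 * K ^ (p + j * P)]. *)
exists (2 * (K ^ p)%:R), (K ^ P)%:R, rho; split => //.
- by rewrite ltr1n -(exp1n P) ltn_exp2r.
- move=> j N x c Xx; have [a' [m' inf]] := Xx 0 N.
  have rho0 : 0 <= rho ^+ j by rewrite exprn_ge0// ltW//; case/andP: rho01.
  have := cnorm_twisted_sum_infix x1 (ltnW K1) szK rho0 (decay c j) inf.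
  rewrite size_map size_iota; congr (_ <= _ + _).
  rewrite -mulrA; congr (2 * _); rewrite -natrX -natrM -expnM -expnD.
  by rewrite (mulnC P).
Qed.

Lemma L2_normsq_ge0 (R : realType) n (zeta : substitution n)
    (mu : probability (borel_seq_space n) R) (f : borel_seq_space n -> R[i]) :
  0 <= L2_normsq zeta mu f.
Proof.
by apply: Rintegral_ge0 => x _; rewrite re_mul_conj sqr_ge0.
Qed.

Unset Implicit Arguments.
Local Close Scope complex_scope.

Theorem theorem2p5 (R : realType) (n : nat) (zeta : substitution n)
    (zeta_aperiodic : aperiodic_subst zeta)
    (zeta_primitive : primitive_subst zeta)
    (zeta_salem : salem_type R zeta)
    (zeta_irreducible : irreducible_char_poly zeta)
    (alpha : R)
    (alphaP : perron_frobenius_eigenvalue (subst_mx zeta) alpha)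
    (mu : probability (borel_seq_space n) R)
    (muP : invariant_probability zeta mu) :
  exists C : R, 0 < C /\
    forall omega : R, 0 < omega < 1 -> in_Q_adjoin alpha omega ->
    exists r0 theta : R, [/\ 0 < r0, 0 < theta &
      forall (r : R) (f : borel_seq_space n -> R[i])
        (sigma_f : {finite_measure set (measurableTypeR R) -> \bar R}),
        0 < r < r0 -> cylindrical0 zeta f ->
        spectral_measure zeta mu f sigma_f ->
        (sigma_f (circle_ball omega r)
           <= (C * L2_normsq zeta mu f * r `^ theta)%:E)%E].
Proof.
(* All constants are absorbed into the exponent by [balance_level], at the price of a smaller
   [r0]. *)
exists 1; split; first exact: ltr01.
move=> w w01 wQ.
have [A [E [rho [A0 E1 rho01 decay]]]] := twisted_sum_decay zeta_primitive zeta_salem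
  zeta_irreducible alphaP w01 wQ.
have c1 : 0 < cos 1 :> R := cos1_gt0 R.
(* This is the factor that remains when the bound from the Fejer kernel is divided by
   [(cos 1 * N) ^+ 2]. *)
have c0 : 0 <= n.+2%:R / cos 1 ^+ 2 :> R by rewrite divr_ge0// sqr_ge0.
have [r0 [theta [r00 theta0 balance]]] := balance_level c0 A0 E1 rho01.
exists r0, theta; split => // r f sigma rr0 fP sigmaP.
have [j [N [N0 Nr rate]]] := balance r rr0.
have N0R : 0 < N%:R :> R by rewrite ltr0n.
have := spectral_measure_ball_le muP fP sigmaP (fun x Xx a => decay j N x a Xx) Nr.
have fin : sigma (circle_ball w r) \is a fin_num.
  by apply: fin_num_measure; exact: measurable_circle_ball.
rewrite -(fineK fin) -EFinM !lee_fin mul1r; set s := fine _; set F := L2_normsq _ _ _.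
move=> le_s.
have F0 : 0 <= F := L2_normsq_ge0 zeta mu f.
rewrite mulrC; apply: (le_trans _ (ler_wpM2r F0 rate)).
rewrite -(ler_pM2l (exprn_gt0 2 (mulr_gt0 c1 N0R))).
apply: (le_trans le_s); rewrite le_eqVlt; apply/orP; left; apply/eqP.
by field; rewrite !gt_eqF.
Qed.
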